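(* Let $Q$ be a quadrilateral with ordered vertices $V_1,\dots,V_4$, let $\boldsymbol{\kappa}$ be a constant symmetric positive-definite $2\times 2$ matrix, let $\{\varphi_i\}_{i=1}^4$ be a set of generalized barycentric coordinates on $Q$, and let $\tau_{\mathrm{VEM}}$ be a real parameter. Then the linear virtual element stiffness matrix $\mathsf{K}_{\mathrm{VEM}}=\mathsf{K}_{\mathrm{C}}+\mathsf{K}_{\mathrm{S}}$ on $Q$ with dofi-dofi stabilization, i.e. $$(\mathsf{K}_{\mathrm{C}})_{ij}=\int_Q\boldsymbol{\kappa}\nabla\Pi^\nabla_1\varphi_j\cdot\nabla\Pi^\nabla_1\varphi_i\,d\boldsymbol{x},\qquad (\mathsf{K}_{\mathrm{S}})_{ij}=\tau_{\mathrm{VEM}}\sum_{k=1}^4\big[(I-\Pi^\nabla_1)\varphi_j\big](V_k)\,\big[(I-\Pi^\nabla_1)\varphi_i\big](V_k),$$ satisfies $$\mathsf{K}_{\mathrm{VEM}}=\mathsf{A}+\tau_{\mathrm{VEM}}\,\mathsf{B},\qquad \mathsf{A}_{ij}=\frac{1}{4|Q|}\,\boldsymbol{\kappa}\,\boldsymbol{d}_j^\perp\cdot\boldsymbol{d}_i^\perp,\qquad \mathsf{B}_{ij}=T_i'\,T_j'.$$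
   Context: A quadrilateral $Q\subset\mathbb{R}^2$ is a (nondegenerate, simple, convex or nonconvex) closed quadrilateral of area $|Q|>0$, with vertices $V_i=(x_i,y_i)$, $i=1,2,3,4$, listed consecutively in counterclockwise order; vertex indices are taken modulo 4. A set of generalized barycentric coordinates on $Q$ is a family $\varphi_1,\dots,\varphi_4\in H^1(Q)\cap C^0(Q)$ such that $\varphi_i(V_j)=\delta_{ij}$, each $\varphi_i$ is affine on each edge of $Q$, and $\sum_i\varphi_i=1$, $\sum_i x_i\varphi_i=x$, $\sum_i y_i\varphi_i=y$ on $Q$. (The linear virtual element spaces on $Q$ are spanned by such families.) The local space is $\mathrm{span}\{\varphi_1,\dots,\varphi_4\}$. Let $P_0$ be either the vertex mean, $P_0v=\frac14\sum_{i=1}^4v(V_i)$, or the boundary mean, $P_0v=\frac{1}{|\partial Q|}\int_{\partial Q}v\,ds$ (either choice is allowed, fixed once; applied componentwise to vectors). For $v$ in the local space, $\Pi^\nabla_1v$ is the polynomial of degree at most one $$\Pi^\nabla_1v(\boldsymbol{x})=\left(\frac{1}{|Q|}\int_Q\nabla v\,d\boldsymbol{x}\right)\cdot(\boldsymbol{x}-P_0\boldsymbol{x})+P_0v .$$ $I$ denotes the identity. $\boldsymbol{d}_i:=V_{i+1}-V_{i-1}$ is the vector joining $V_{i-1}$ to $V_{i+1}$, and $\boldsymbol{d}_i^\perp$ is its clockwise rotation by $90^\circ$, i.e. $(a,b)^\perp=(b,-a)$. $T_i$ is the signed area of the triangle obtained by removing vertex $V_i$ from $Q$: $T_i=\frac12\det\begin{bmatrix}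 1 & 1 & 1 \\ x_p & x_q & x_r \\ y_p & y_q & y_r \end{bmatrix}$, where $p<q<r$ and $\{p,q,r\}=\{1,2,3,4\}\setminus\{i\}$. Finally $T_i':=(-1)^i\,T_i/|Q|$. *)

(* Defs.v *)
From HB Require Import structures.
From mathcomp Require Import all_boot all_order all_algebra.
From mathcomp Require Import all_classical all_reals all_analysis.

Set Implicit Arguments.
Unset Strict Implicit.
Unset Printing Implicit Defensive.

Import Order.TTheory GRing.Theory Num.Theory.
Import numFieldNormedType.Exports.

Local Open Scope classical_set_scope.
Local Open Scope ring_scope.

(* Points of the plane are pairs, because [R * R] carries the product
   topology, sigma-algebra and measure; [colv] turns a pair into a column
   vector on which 2 x 2 matrices act. *)
Definition colv {R : realType} (p : R * R) : 'cV[R]_2 :=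
  \col_k (if k == 0 then p.1 else p.2).

Definition dot {R : realType} (u v : 'cV[R]_2) : R := (u^T *m v) 0 0.

Definition sym_posdef {R : realType} (kappa : 'M[R]_2) : Prop :=
  kappa^T = kappa /\ forall v : 'cV[R]_2, v != 0 -> 0 < dot (kappa *m v) v.

Definition mu2 {R : realType} :
    {measure set (measurableTypeR R * measurableTypeR R)%type
       -> \bar R} :=
  (@lebesgue_measure R \x @lebesgue_measure R)%E.

Definition basis2 {R : realType} (k : 'I_2) : R * R :=
  if k == 0 then (1, 0) else (0, 1).

Definition partial {R : realType} (k : 'I_2) (f : R * R -> R) : R * R -> R :=
  fun x => 'D_(basis2 k) f x.

Definition grad {R : realType} (f : R * R -> R) (x : R * R) : 'cV[R]_2 :=
  \col_k partial k f x.

(* C^n on the whole plane. *)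
Fixpoint Ck {R : realType} (n : nat) (f : R * R -> R) : Prop :=
  continuous f /\
  if n is m.+1 then
    forall k, (forall x, derivable f x (basis2 k)) /\ Ck m (partial k f)
  else True.

Definition test_function {R : realType} (U : set (R * R)) (psi : R * R -> R) :
    Prop :=
  let supp := closure [set x | psi x != 0] in
  [/\ forall n, Ck n psi, compact supp & supp `<=` U].

(* Elements of L^2(Q) and H^1(Q) are represented by functions on the plane
   whose values outside Q are irrelevant: [f \_ Q] is f extended by 0. *)
Definition in_L2 {R : realType} (Q : set (R * R)) (f : R * R -> R) : Prop :=
  f \_ Q \in Lfun (@mu2 R) 2%:E.

Definition is_weak_partial {R : realType} (Q : set (R * R)) (k : 'I_2)
    (v g : R * R -> R) : Prop :=
  forall psi, test_function Q° psi ->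
    \int[mu2]_(x in Q) (v x * partial k psi x) =
    - \int[mu2]_(x in Q) (g x * psi x).

Definition in_H1 {R : realType} (Q : set (R * R)) (v : R * R -> R) : Prop :=
  in_L2 Q v /\ forall k, exists g, in_L2 Q g /\ is_weak_partial Q k v g.

(* A chosen representative of the weak gradient (unique up to a null set). *)
Definition weak_partial {R : realType} (Q : set (R * R)) (k : 'I_2)
    (v : R * R -> R) : R * R -> R :=
  xget (fun=> 0) [set g | in_L2 Q g /\ is_weak_partial Q k v g].

Definition weak_grad {R : realType} (Q : set (R * R)) (v : R * R -> R)
    (x : R * R) : 'cV[R]_2 :=
  \col_k weak_partial Q k v x.

(* Vertices are indexed by 'I_4 = {0, 1, 2, 3}, whose canonical ring structure
   is arithmetic modulo 4; the ordinal i stands for the vertex of index i.+1 in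
   1-based numbering. *)

Definition seg {R : realType} (a b : R * R) (t : R) : R * R :=
  (1 - t) *: a + t *: b.

Definition edge {R : realType} (V : 'I_4 -> R * R) (i : 'I_4) : set (R * R) :=
  seg (V i) (V (i + 1)) @` `[0, 1]%classic.

Definition quad_boundary {R : realType} (V : 'I_4 -> R * R) : set (R * R) :=
  \bigcup_i edge V i.

(* The closed region enclosed by the boundary curve: the curve together with
   the bounded connected components of its complement. *)
Definition quad {R : realType} (V : 'I_4 -> R * R) : set (R * R) :=
  quad_boundary V `|`
  [set x | ~ quad_boundary V x /\
           bounded_set (connected_component (~` quad_boundary V) x)].

Definition simple_quad {R : realType} (V : 'I_4 -> R * R) : Prop :=
  [/\ injective V,
      forall i, edge V i `&` edge V (i + 1) = [set V (i + 1)] &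
      forall i, edge V i `&` edge V (i + 2) = set0].

(* Shoelace formula: positive exactly for a counterclockwise simple polygon. *)
Definition shoelace {R : realType} (V : 'I_4 -> R * R) : R :=
  2^-1 * \sum_i ((V i).1 * (V (i + 1)).2 - (V (i + 1)).1 * (V i).2).

Definition ccw_quadrilateral {R : realType} (V : 'I_4 -> R * R) : Prop :=
  simple_quad V /\ 0 < shoelace V.

Definition area {R : realType} (Q : set (R * R)) : R := fine (mu2 Q).

Definition edge_length {R : realType} (V : 'I_4 -> R * R) (i : 'I_4) : R :=
  let e := colv (V (i + 1) - V i) in Num.sqrt (dot e e).

Definition vertex_mean {R : realType} (V : 'I_4 -> R * R) (v : R * R -> R) : R :=
  4^-1 * \sum_i v (V i).

Definition boundary_integral {R : realType} (V : 'I_4 -> R * R)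
    (v : R * R -> R) : R :=
  \sum_i edge_length V i *
    \int[lebesgue_measure]_(t in `[0, 1]) v (seg (V i) (V (i + 1)) t).

Definition boundary_mean {R : realType} (V : 'I_4 -> R * R)
    (v : R * R -> R) : R :=
  (\sum_i edge_length V i)^-1 * boundary_integral V v.

Definition gbc {R : realType} (V : 'I_4 -> R * R) (phi : 'I_4 -> R * R -> R) :
    Prop :=
  [/\ forall i, in_H1 (quad V) (phi i) /\ {within quad V, continuous (phi i)},
      forall i j, phi i (V j) = (i == j)%:R,
      forall i j t, 0 <= t <= 1 ->
        phi i (seg (V j) (V (j + 1)) t) =
        (1 - t) * phi i (V j) + t * phi i (V (j + 1)) &
      forall x, quad V x ->
        [/\ \sum_i phi i x = 1,
            \sum_i (V i).1 * phi i x = x.1 &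
            \sum_i (V i).2 * phi i x = x.2]].

(* The projector Pi^nabla_1; P0 is applied componentwise to the position
   vector. *)
Definition Pi1 {R : realType} (Q : set (R * R)) (P0 : (R * R -> R) -> R)
    (v : R * R -> R) (x : R * R) : R :=
  dot ((area Q)^-1 *: \col_k \int[mu2]_(y in Q) weak_grad Q v y k 0)
      (colv (x - (P0 fst, P0 snd))) + P0 v.

(* Pi1 ... v is a polynomial, so its gradient is the classical one. *)
Definition K_C {R : realType} (V : 'I_4 -> R * R) (P0 : (R * R -> R) -> R)
    (kappa : 'M[R]_2) (phi : 'I_4 -> R * R -> R) : 'M[R]_4 :=
  \matrix_(i, j) \int[mu2]_(x in quad V)
    dot (kappa *m grad (Pi1 (quad V) P0 (phi j)) x)
        (grad (Pi1 (quad V) P0 (phi i)) x).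

Definition K_S {R : realType} (V : 'I_4 -> R * R) (P0 : (R * R -> R) -> R)
    (tau : R) (phi : 'I_4 -> R * R -> R) : 'M[R]_4 :=
  \matrix_(i, j) (tau * \sum_k
    (phi j (V k) - Pi1 (quad V) P0 (phi j) (V k)) *
    (phi i (V k) - Pi1 (quad V) P0 (phi i) (V k))).

Definition K_VEM {R : realType} (V : 'I_4 -> R * R) (P0 : (R * R -> R) -> R)
    (kappa : 'M[R]_2) (tau : R) (phi : 'I_4 -> R * R -> R) : 'M[R]_4 :=
  K_C V P0 kappa phi + K_S V P0 tau phi.

(* Clockwise rotation by 90 degrees. *)
Definition perp {R : realType} (p : R * R) : R * R := (p.2, - p.1).

Definition diag_vec {R : realType} (V : 'I_4 -> R * R) (i : 'I_4) : R * R :=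
  V (i + 1) - V (i - 1).

(* [lift i] enumerates increasingly the three indices different from i. *)
Definition Tsigned {R : realType} (V : 'I_4 -> R * R) (i : 'I_4) : R :=
  2^-1 * \det (\matrix_(r < 3, c < 3)
                 [:: 1; (V (lift i c)).1; (V (lift i c)).2]`_r).

(* The exponent is the 1-based index of the vertex. *)
Definition Tprime {R : realType} (V : 'I_4 -> R * R) (i : 'I_4) : R :=
  (-1) ^+ i.+1 * Tsigned V i / area (quad V).

(* Main.v *)
Require Import Defs.
From HB Require Import structures.
From mathcomp Require Import all_boot all_order all_algebra.
From mathcomp Require Import all_classical all_reals all_analysis.
From mathcomp Require Import measurable_realfun.
From mathcomp Require Import ring lra.
Import Order.TTheory GRing.Theory Num.Theory.
Import numFieldNormedType.Exports.
Local Open Scope classical_set_scope.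
Local Open Scope ring_scope.

Set Implicit Arguments.
Unset Strict Implicit.
Unset Printing Implicit Defensive.

(** A weak derivative g of a continuous function v is tested against smooth
    cutoffs of a trapezoid with two vertical sides. As the cutoffs tend to 1,
    the integral of g over the trapezoid becomes the integral of the difference
    of v between the upper and the lower side. A triangle is the union of two
    such trapezoids, and the quadrilateral is the union of the two triangles
    cut out by a suitable diagonal, along which the contributions cancel. Since
    the coordinates are affine on the edges, only their vertex values remain:
    the integral of grad phi_i is half of d_i^perp, which gives the matrix A.
    The same computation with g = 1 and v = y gives the area.

    The vertex values of (I - Pi) phi_j are then explicit, and they equal
    T_j'/2 up to an alternating sign: the alternating combination of the phi_j
    has zero mean gradient and zero P0, hence is fixed by I - Pi, while the
    three affine combinations are annihilated. Summing the products over the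
    four vertices gives the matrix B. *)

(** * Smooth cutoff functions *)

(** The obstacle is that the gradients are known only through test functions with compact support in
    the interior, so boundary values have to be reached by a limit. Vertical sides make that limit
    one-dimensional: on each vertical section the y-derivative of the cutoff is a kernel that
    concentrates with mass 1 at the lower end and -1 at the upper end. Continuity on closed sections
    then replaces a trace argument, and Fubini with dominated convergence concludes. Only the
    y-derivative is treated in this way; the x-derivative follows by exchanging the coordinates.

    A second difficulty is that the region is given topologically, through bounded components of the
    complement of its boundary. Some diagonal cuts it into two positively oriented triangles, since
    otherwise two opposite edges would meet; the union of these triangles is identified with the
    region by a clopen argument inside and an unbounded ray outside.

    The choice of [P0] matters only through its vertex weights, which sum to 1/2 on each pair of
    opposite vertices. *)

Section smooth_functions.
Context {R : realType}.
Implicit Types (f g : R * R -> R) (x : R * R).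

Lemma is_derive_congr (V : normedModType R) (f g : V -> R) (x v : V) (d e : R) :
  is_derive x v f d -> f =1 g -> d = e -> is_derive x v g e.
Proof. by move=> df /funext <- <-. Qed.

(** Turns a directional derivative in the plane into a one-variable derivative, where the chain rule
    and the rule for inverses can be applied. *)
Lemma is_derive_line (V : normedModType R) (f : V -> R) (x v : V) (d : R) :
  is_derive x v f d <-> is_derive (0 : R) 1 (fun h : R => f (h *: v + x)) d.
Proof.
have e : 'D_v f x = 'D_1 (fun h : R => f (h *: v + x)) 0.
  rewrite /derive; set g1 := fun h => h^-1 *: _; set g2 := fun h => h^-1 *: _.
  suff -> : g1 = g2 by [].
  by apply/funext => h; rewrite /g1 /g2/= addr0 scale0r add0r [_%:A]mulr1.
split=> -[df dv]; apply: DeriveDef.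
- exact: (iffLR (derivable1P f x v)).
- by rewrite -e.
- exact: (iffRL (derivable1P f x v)).
- by rewrite e.
Qed.

Lemma is_derive_affine (phi : R -> R) (a b c d : R) x (v : R * R) :
  is_derive (a * x.1 + b * x.2 + c) 1 phi d ->
  is_derive x v (fun p : R * R => phi (a * p.1 + b * p.2 + c))
    ((a * v.1 + b * v.2) * d).
Proof.
move=> dphi; apply/is_derive_line => /=.
pose l h := (a * v.1 + b * v.2) * h + (a * x.1 + b * x.2 + c).
have -> : (fun h : R => phi (a * (h * v.1 + x.1) + b * (h * v.2 + x.2) + c))
   = phi \o l.
  by apply/funext => h; rewrite /l /=; congr phi; ring.
have dl : is_derive (0 : R) 1 l (a * v.1 + b * v.2).
  apply: (@is_derive_congr _ (((a * v.1 + b * v.2) \*: (@id R)) +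
      cst (a * x.1 + b * x.2 + c))) => //.
  by rewrite addr0 [_ *: _]mulr1.
have dphi' : is_derive (l 0) 1 phi d by rewrite /l mulr0 add0r.
have := @is_derive1_comp _ phi l 0 _ _ dphi' dl.
by rewrite mulrC.
Qed.

(** The classical function exp(-1/t), flat at 0, with a power of 1/t in front: differentiation
    raises that power, so the whole family is needed for closure. *)
Definition flat (n : nat) (t : R) : R :=
  if 0 < t then t ^- n * expR (- t^-1) else 0.

Lemma flat_ge0 n t : 0 <= flat n t.
Proof.
rewrite /flat; case: ifP => // t0.
by rewrite mulr_ge0 ?expR_ge0// invr_ge0 exprn_ge0// ltW.
Qed.

(** The exponential series at 1/t gives exp(1/t) >= t^-(n+1) / (n+1)!. A bound linear in t is all
    that the behaviour at 0 requires. *)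
Lemma flat_le n t : 0 < t -> flat n t <= (n.+1)`!%:R * t.
Proof.
move=> t0; rewrite /flat t0.
have s0 : 0 < t^-1 by rewrite invr_gt0.
have := expR_ge1Dxn n (ltW s0) => h.
have {}h : t^-1 ^+ n.+1 / (n.+1)`!%:R <= expR t^-1 by lra.
rewrite expRN ler_pdivrMr ?expR_gt0//.
apply: le_trans (ler_wpM2l _ h); last by rewrite mulr_ge0// ltW.
have n0 : (n.+1)`!%:R != 0 :> R by rewrite pnatr_eq0 -lt0n fact_gt0.
rewrite exprVn le_eqVlt; apply/orP; left; apply/eqP.
have t0' : t != 0 by rewrite gt_eqF.
by rewrite exprS; field; rewrite n0 t0' expf_neq0.
Qed.

Lemma is_derive_flat n (t : R) :
  is_derive t 1 (flat n) (flat n.+2 t - n%:R * flat n.+1 t).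
Proof.
have [t0|t0|<-] := ltgtP 0 t.
- have dV : is_derive t 1 (fun y : R => y^-1) (- t ^- 2).
    have := @is_deriveV _ id t 1 1 (lt0r_neq0 t0) (is_derive_id _ _).
    by move=> h; apply: (is_derive_congr h) => //; rewrite [_ *: _]mulr1.
  have dE : is_derive t 1 (fun y : R => expR (- y^-1))
                          (expR (- t^-1) * t ^- 2).
    have dN := @is_deriveN _ _ _ _ _ _ _ dV.
    have := @is_derive1_comp _ expR (- (fun y : R => y^-1)) t _ _
       (is_derive_expR _) dN.
    by move=> h; apply: (is_derive_congr h) => //; rewrite opprK.
  have dX : is_derive t 1 (fun y : R => y^-1 ^+ n) (n%:R * t^-1 ^+ n.-1 * - t ^- 2).
    have h := @is_deriveX _ _ _ n _ _ _ dV.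
    by apply: (is_derive_congr h) => // y; elim: (n) => [|m IH]; rewrite ?expr0// !exprS -IH.
  have dM : is_derive t 1 (fun y : R => y^-1 ^+ n * expR (- y^-1))
     (flat n.+2 t - n%:R * flat n.+1 t).
    apply: (is_derive_congr (is_deriveM dX dE)) => //.
    rewrite /flat t0 -!exprVn /= /GRing.scale /=.
    case: n {dX} => [|n]; rewrite ?exprS/=; ring.
  apply: near_eq_is_derive dM.
  near=> y; rewrite /flat exprVn ifT//.
  by near: y; apply: lt_nbhsr.
- have d0 : is_derive t 1 (cst 0 : R -> R) 0 by apply: is_derive_cst.
  rewrite {2 3}/flat ltNge (ltW t0)/= mulr0 subr0.
  apply: near_eq_is_derive d0; near=> y; rewrite /flat ifF//.
  by apply/negbTE; rewrite -leNgt ltW//; near: y; apply: lt_nbhsl.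
- rewrite {2 3}/flat ltxx mulr0 subr0.
  have H : (fun h : R => h^-1 *: ((flat n \o shift 0) (h *: 1) - flat n 0))
     @ 0^' --> (0 : R).
    apply/cvgrPdist_le => e e0; near=> h.
    rewrite /= sub0r normrN addr0 [h *: 1]mulr1 {2}/flat ltxx subr0.
    have [h0|h0] := ltP 0 h; last by rewrite /flat ltNge h0 scaler0 normr0 ltW.
    (* The right difference quotient at 0 is the next member of the family, so [flat_le] for [n.+1]
       makes it tend to 0. *)
    have -> : h^-1 *: flat n h = flat n.+1 h.
      by rewrite /flat h0 /GRing.scale/= exprS invfM mulrA.
    rewrite ger0_norm ?flat_ge0//; apply: le_trans (flat_le _ h0) _.
    rewrite -ler_pdivlMl ?ltr0n ?fact_gt0//.
    near: h; apply: nbhs_dnbhs; near=> h.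
    apply: le_trans (ler_norm _) _; near: h.
    have e1 : 0 < ((n.+2)`!%:R)^-1 * e by rewrite mulr_gt0// invr_gt0 ltr0n fact_gt0.
    have := @nbhs0_le _ R _ e1; exact.
  by apply: DeriveDef; [apply/cvg_ex; exists 0|apply/cvg_lim].
Unshelve. all: by end_near. Qed.

(* A class of C^infinity functions closed under partial derivatives, rich
   enough to contain the cutoffs below. *)
Inductive smooth : (R * R -> R) -> Prop :=
| smooth_flat n (a b c : R) :
    smooth (fun p => flat n (a * p.1 + b * p.2 + c))
| smooth_cst (c : R) : smooth (fun=> c)
| smoothD f g : smooth f -> smooth g -> smooth (fun p => f p + g p)
| smoothM f g : smooth f -> smooth g -> smooth (fun p => f p * g p)
| smoothV f : (forall p, f p != 0) -> smooth f -> smooth (fun p => (f p)^-1).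

Lemma smoothN f : smooth f -> smooth (fun p => - f p).
Proof.
move=> sf; have -> : (fun p => - f p) = (fun p => -1 * f p).
  by apply/funext => p; rewrite mulN1r.
exact: smoothM (smooth_cst _) sf.
Qed.

Lemma flat_continuous n : continuous (flat n).
Proof.
move=> t; apply: differentiable_continuous; apply/derivable1_diffP.
by have [] := is_derive_flat n t.
Qed.

Lemma smooth_continuous f : smooth f -> continuous f.
Proof.
elim=> {f} [n a b c|c|f g _ cf _ cg|f g _ cf _ cg|f f0 _ cf] x.
- apply: (@continuous_comp _ _ _ (fun p : R * R => a * p.1 + b * p.2 + c)).
    apply: cvgD; last exact: cvg_cst.
    apply: cvgD; apply: cvgM; try exact: cvg_cst; [exact: cvg_fst|exact: cvg_snd].
  exact: flat_continuous.
- exact: cvg_cst.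
- exact: cvgD (cf x) (cg x).
- exact: cvgM (cf x) (cg x).
- exact: cvgV (f0 x) (cf x).
Qed.

Lemma smooth_measurable f : smooth f ->
  measurable_fun [set: measurableTypeR R * measurableTypeR R] f.
Proof.
elim=> {f} [n a b c|c|f g _ mf _ mg|f g _ mf _ mg|f f0 _ mf].
- apply: (@measurableT_comp _ _ _ _ _ _ (flat n)).
    by apply: continuous_measurable_fun; exact: flat_continuous.
  apply: measurable_funD; last exact: measurable_cst.
  apply: measurable_funD; apply: measurable_funM; try exact: measurable_cst.
    exact: measurable_fst.
  exact: measurable_snd.
- exact: measurable_cst.
- exact: measurable_funD.
- exact: measurable_funM.
- have oD : open [set y : R | y != 0] by exact: open_neq.
  apply: (@measurable_comp _ _ _ _ _ _ [set y : R | y != 0] (@GRing.inv R)) => //.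
  + exact: open_measurable.
  + by move=> _ [p _ <-]; exact: f0.
  + apply: open_continuous_measurable_fun => // y /[!inE] y0.
    exact: inv_continuous.
Qed.

Lemma smooth_derive f (v : R * R) : smooth f ->
  exists2 g, smooth g & forall x, is_derive x v f (g x).
Proof.
elim=> {f} [n a b c|c|f f' sf [g sg dg] sf' [g' sg' dg']
           |f f' sf [g sg dg] sf' [g' sg' dg']|f f0 sf [g sg dg]].
- exists (fun p => (a * v.1 + b * v.2) *
    (flat n.+2 (a * p.1 + b * p.2 + c) +
     - n%:R * flat n.+1 (a * p.1 + b * p.2 + c))).
    apply: smoothM; first exact: smooth_cst.
    apply: smoothD; first exact: smooth_flat.
    by apply: smoothM; [exact: smooth_cst|exact: smooth_flat].
  by move=> x; apply: is_derive_affine; rewrite mulNr; exact: is_derive_flat.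
- by exists (fun=> 0); [exact: smooth_cst|move=> x; exact: is_derive_cst].
- by exists (fun p => g p + g' p); [exact: smoothD|move=> x; exact: is_deriveD].
- exists (fun p => f p * g' p + f' p * g p).
    by apply: smoothD; exact: smoothM.
  by move=> x; exact: is_deriveM.
- exists (fun p => - ((f p)^-1 * (f p)^-1) * g p).
    apply: smoothM => //; apply: smoothN; apply: smoothM; exact: smoothV.
  move=> x; apply/is_derive_line.
  have /is_derive_line dgx := dg x.
  have f1 : f ((0 : R) *: v + x) != 0 by exact: f0.
  apply: (is_derive_congr (@is_deriveV _ _ _ _ _ f1 dgx)) => //.
  by rewrite scale0r add0r /GRing.scale/= expr2 invfM.
Qed.

Lemma smooth_Ck n f : smooth f -> Ck n f.
Proof.
elim: n f => [|n IH] f sf; first by split; first exact: smooth_continuous.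
split; first exact: smooth_continuous.
move=> k; have [g sg dg] := smooth_derive (basis2 k) sf.
split=> [x|]; first by have [] := dg x.
suff -> : partial k f = g by exact: IH.
by apply/funext => x; rewrite /partial; have [] := dg x.
Qed.

End smooth_functions.

(** * A smooth step and the derivative of a smoothed interval indicator *)

Section step_function.
Context {R : realType}.
Notation leb := (@lebesgue_measure R).

Lemma Rintegral_restrict d (T : measurableType d)
    (mu : {measure set T -> \bar R}) (D E : set T) (f : T -> R) :
  E `<=` D -> (forall x, D x -> ~ E x -> f x = 0) ->
  \int[mu]_(x in D) f x = \int[mu]_(x in E) f x.
Proof.
move=> ED f0; rewrite Rintegral_mkcond [RHS]Rintegral_mkcond.
congr (Rintegral _ _ _); apply/funext => x; rewrite /patch.
have [xE|xE] := pselect (E x); first by rewrite !mem_set//; exact: ED.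
rewrite (memNset xE); case: ifPn => // /set_mem Dx; exact: f0.
Qed.

Lemma continuous_itv_integrable (a b : R) (f : R -> R) :
  {within `[a, b], continuous f} -> leb.-integrable `[a, b] (EFin \o f).
Proof. by move=> cf; apply: continuous_compact_integrable => //; exact: segment_compact. Qed.

(** Only the part of [D] inside [p, q] contributes, and its measure is at most q - p even if [D]
    does not contain [p, q]. Below, q - p is 1/N and [C] is of order N. *)
Lemma kernel_bound (D : set R) (p q C : R) (f : R -> R) :
  measurable D -> p <= q ->
  leb.-integrable D (EFin \o f) ->
  (forall y, D y -> ~ (p <= y <= q) -> f y = 0) ->
  (forall y, D y -> p <= y <= q -> `|f y| <= C) -> 0 <= C ->
  `|\int[leb]_(y in D) f y| <= C * (q - p).
Proof.
move=> mD pq intf f0 fC C0.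
have mpq : measurable (`[p, q]%classic : set R) by [].
have mE : measurable (D `&` `[p, q]%classic) by exact: measurableI.
have intfE : leb.-integrable (D `&` `[p, q]%classic) (EFin \o f).
  by apply: integrableS intf => //; exact: subIsetl.
have pqE : leb `[p, q] = (q - p)%:E.
  rewrite lebesgue_measure_itv/= lte_fin; case: ltP => //.
  by move=> qp; have -> : q = p; [lra|rewrite subrr].
have leE : (leb (D `&` `[p, q]%classic) <= (q - p)%:E)%E.
  by rewrite -pqE; apply: le_measure; rewrite ?inE//; exact: subIsetr.
rewrite (@Rintegral_restrict _ _ leb D (D `&` `[p, q]%classic)); last 2 first.
  exact: subIsetl.
  move=> y Dy nE; apply: f0 => // ypq; apply: nE; split => //.
apply: le_trans (le_normr_Rintegral _ intfE) _ => //.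
apply: (@le_trans _ _ (\int[leb]_(y in D `&` `[p, q]%classic) C)).
  apply: le_Rintegral => //.
  - exact: integrable_norm.
  - apply: measurable_bounded_integrable => //.
      by apply: le_lt_trans leE _; rewrite ltry.
    exists C; split; first exact: num_real.
    by move=> x Cx y _ /=; rewrite ger0_norm// ltW.
  - by move=> y [Dy]; rewrite /= in_itv/=; exact: fC.
rewrite Rintegral_cst// ler_wpM2l//.
rewrite -lee_fin fineK//; apply/fin_numP; split.
  by rewrite gt_eqF// (lt_le_trans (ltNyr 0))// measure_ge0.
by rewrite lt_eqF// (le_lt_trans leE)// ltry.
Qed.

(** The transition takes place on [1, 2] rather than [0, 1]: [step (N * t)] then vanishes up to t =
    1/N, which keeps the supports of the cutoffs away from the boundary. *)
Definition step (t : R) : R := flat 0 (t - 1) / (flat 0 (t - 1) + flat 0 (2 - t)).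

Lemma step_den_gt0 (t : R) : 0 < flat 0 (t - 1) + flat 0 (2 - t).
Proof.
have [t1|t1] := ltP 1 t.
  apply: ltr_wpDr; first exact: flat_ge0.
  by rewrite /flat ifT ?subr_gt0// expr0 invr1 mul1r expR_gt0.
apply: ltr_wpDl; first exact: flat_ge0.
by rewrite /flat ifT ?expr0 ?invr1 ?mul1r ?expR_gt0//; lra.
Qed.

Lemma step_ge0 (t : R) : 0 <= step t.
Proof. by rewrite /step divr_ge0 ?flat_ge0// ltW// step_den_gt0. Qed.

Lemma step_le1 (t : R) : step t <= 1.
Proof. by rewrite /step ler_pdivrMr ?step_den_gt0// mul1r lerDl flat_ge0. Qed.

Lemma step_eq0 (t : R) : t <= 1 -> step t = 0.
Proof. by move=> t1; rewrite /step {1}/flat ifF ?mul0r//; apply/negbTE; rewrite -leNgt; lra. Qed.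

Lemma step_eq1 (t : R) : 2 <= t -> step t = 1.
Proof.
move=> t2; have := step_den_gt0 t; rewrite /step.
have -> : flat 0 (2 - t) = 0.
  by rewrite /flat ifF//; apply/negbTE; rewrite -leNgt; lra.
by rewrite addr0 => h; rewrite divff// gt_eqF.
Qed.

Lemma smooth_step (a b c : R) : smooth (fun p => step (a * p.1 + b * p.2 + c)).
Proof.
rewrite /step; apply: smoothM.
  have -> : (fun p : R * R => flat 0 (a * p.1 + b * p.2 + c - 1)) =
            (fun p => flat 0 (a * p.1 + b * p.2 + (c - 1))).
    by apply/funext => p; rewrite addrA.
  exact: smooth_flat.
apply: smoothV => [p|]; first by rewrite gt_eqF// step_den_gt0.
apply: smoothD.
  have -> : (fun p : R * R => flat 0 (a * p.1 + b * p.2 + c - 1)) =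
            (fun p => flat 0 (a * p.1 + b * p.2 + (c - 1))).
    by apply/funext => p; rewrite addrA.
  exact: smooth_flat.
have -> : (fun p : R * R => flat 0 (2 - (a * p.1 + b * p.2 + c))) =
          (fun p => flat 0 (- a * p.1 + - b * p.2 + (2 - c))).
  by apply/funext => p; congr flat; ring.
exact: smooth_flat.
Qed.

Lemma step_derive : exists2 dh : R -> R, continuous dh &
  forall t : R, is_derive t 1 step (dh t).
Proof.
have [g sg dg] := smooth_derive (1, 0) (smooth_step 1 0 0).
exists (fun t => g (t, 0)).
  move=> t; apply: (@continuous_comp _ _ _ (fun t : R => (t, 0 : R))).
    by apply: (@cvg_pair _ _ _ _ (nbhs t) (nbhs (0:R))); [exact: cvg_id|exact: cvg_cst].
  exact: smooth_continuous.
move=> t; apply/is_derive_line.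
have /is_derive_line := dg (t, 0); move/is_derive_congr; apply => // h /=.
by rewrite mul0r !addr0 mul1r [_ *: _]mulr1.
Qed.

(** No closed formula is needed: continuity, together with vanishing where [step] is locally
    constant, already gives a global bound. *)
Definition dstep : R -> R := sval (cid2 step_derive).

Lemma dstep_continuous : continuous dstep.
Proof. by rewrite /dstep; case: cid2. Qed.

Lemma is_derive_step (t : R) : is_derive t 1 step (dstep t).
Proof. by rewrite /dstep; case: cid2. Qed.

Lemma step_continuous : continuous step.
Proof.
move=> t; apply: differentiable_continuous; apply/derivable1_diffP.
by have [] := is_derive_step t.
Qed.

Lemma dstep_eq0 (t : R) : (t < 1) || (2 < t) -> dstep t = 0.
Proof.
have [_ <-] := is_derive_step t.
case/orP => t1.
  rewrite -(derive_cst (0 : R) t 1); apply: near_eq_derive.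
  by near=> y; rewrite step_eq0// ltW//; near: y; exact: lt_nbhsl.
rewrite -(derive_cst (1 : R) t 1); apply: near_eq_derive.
by near=> y; rewrite step_eq1// ltW//; near: y; exact: lt_nbhsr.
Unshelve. all: by end_near. Qed.

Lemma dstep_bounded : exists2 M : R, 0 <= M & forall t : R, `|dstep t| <= M.
Proof.
have cn : {within `[1, 2], continuous (fun t => `|dstep t|)}.
  apply: continuous_subspaceT => t.
  apply: (@continuous_comp _ _ _ dstep (fun y : R => `|y|)).
    exact: dstep_continuous.
  exact: norm_continuous.
have [c _ cM] := @EVT_max R _ 1 2 ltac:(lra) cn.
exists `|dstep c| => // t.
have [t12|] := boolP (t \in `[1, 2]); first exact: cM.
rewrite in_itv/= negb_and -!ltNge => t12.
by rewrite dstep_eq0// normr0.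
Qed.

(* The derivative of y |-> step (N (y - lo)) * step (N (hi - y)), a smooth
   approximation of the indicator function of [lo, hi]. *)
Definition kern (N lo hi y : R) : R :=
  N * dstep (N * (y - lo)) * step (N * (hi - y)) -
  N * step (N * (y - lo)) * dstep (N * (hi - y)).

Lemma is_derive_kern (N lo hi y : R) :
  is_derive y 1 (fun y => step (N * (y - lo)) * step (N * (hi - y)))
    (kern N lo hi y).
Proof.
have d1 : is_derive y 1 (fun y => step (N * (y - lo))) (N * dstep (N * (y - lo))).
  have dl : is_derive y 1 (fun y => N * (y - lo)) N.
    apply: (@is_derive_congr _ _ (N \*: ((@id R) - cst lo))) => //.
    by rewrite subr0 [_ *: _]mulr1.
  have := @is_derive1_comp _ step (fun y => N * (y - lo)) y _ _ (is_derive_step _) dl.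
  by move/is_derive_congr; apply => //; rewrite mulrC.
have d2 : is_derive y 1 (fun y => step (N * (hi - y))) (- N * dstep (N * (hi - y))).
  have dl : is_derive y 1 (fun y => N * (hi - y)) (- N).
    apply: (@is_derive_congr _ _ (N \*: (cst hi - (@id R)))) => //.
    by rewrite sub0r scalerN [_ *: _]mulr1.
  have := @is_derive1_comp _ step (fun y => N * (hi - y)) y _ _ (is_derive_step _) dl.
  by move/is_derive_congr; apply => //; rewrite mulrC.
apply: (is_derive_congr (is_deriveM d1 d2)) => //.
rewrite /kern /GRing.scale/=; ring.
Qed.

Lemma kern_parts_continuous (N lo hi : R) :
  [/\ continuous (fun y => N * dstep (N * (y - lo)) * step (N * (hi - y))) &
      continuous (fun y => N * step (N * (y - lo)) * dstep (N * (hi - y)))].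
Proof.
have c1 : continuous (fun y => N * (y - lo)).
  by move=> y; apply: cvgM; [exact: cvg_cst|apply: cvgB; [exact: cvg_id|exact: cvg_cst]].
have c2 : continuous (fun y => N * (hi - y)).
  by move=> y; apply: cvgM; [exact: cvg_cst|apply: cvgB; [exact: cvg_cst|exact: cvg_id]].
have cs (f : R -> R) : continuous f -> continuous (fun y => f (N * (y - lo))).
  by move=> cf y; apply: (@continuous_comp _ _ _ (fun y => N * (y - lo)) f); [exact: c1|exact: cf].
have cs' (f : R -> R) : continuous f -> continuous (fun y => f (N * (hi - y))).
  by move=> cf y; apply: (@continuous_comp _ _ _ (fun y => N * (hi - y)) f); [exact: c2|exact: cf].
split=> y; (apply: cvgM; [apply: cvgM; [exact: cvg_cst|]|]).
- exact: cs dstep_continuous _.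
- exact: cs' step_continuous _.
- exact: cs step_continuous _.
- exact: cs' dstep_continuous _.
Qed.

Lemma kern_continuous (N lo hi : R) : continuous (kern N lo hi).
Proof.
have [c1 c2] := kern_parts_continuous N lo hi.
by move=> y; exact: cvgB (c1 y) (c2 y).
Qed.

Lemma integral_kern (N lo hi a b : R) : a < b ->
  \int[leb]_(y in `[a, b]) kern N lo hi y =
  step (N * (b - lo)) * step (N * (hi - b)) -
  step (N * (a - lo)) * step (N * (hi - a)).
Proof.
move=> ab; pose F y := step (N * (y - lo)) * step (N * (hi - y)).
have dF (y : R) : is_derive y 1 F (kern N lo hi y) by exact: is_derive_kern.
have cF : continuous F.
  move=> y; apply: differentiable_continuous; apply/derivable1_diffP.
  by have [] := dF y.
rewrite /Rintegral (@continuous_FTC2 _ _ F)//.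
- apply: continuous_subspaceT; exact: kern_continuous.
- split; first by move=> y _; have [] := dF y.
    by apply: cvg_at_right_filter; exact: cF.
  by apply: cvg_at_left_filter; exact: cF.
- by move=> y _; rewrite derive1E; have [] := dF y.
Qed.

End step_function.

(** * Concentration of the kernel at the two ends of an interval *)

Section strip.
Context {R : realType}.
Notation leb := (@lebesgue_measure R).

Lemma nbhs_infty_gtr_S (r : R) : \forall n \near \oo, r < n.+1%:R.
Proof.
near=> n; apply: (@lt_trans _ _ n%:R); last by rewrite ltr_nat.
by near: n; exact: nbhs_infty_gtr.
Unshelve. all: by end_near. Qed.

Lemma normrM_le (a b A B : R) : `|a| <= A -> `|b| <= B -> `|a * b| <= A * B.
Proof. by move=> aA bB; rewrite normrM ler_pM. Qed.

(** Each of the two bumps has height of order N and width 1/N. The constant does not depend on [n],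
    [lo] or [hi], so it can dominate the section integrals of a trapezoid whose height varies and
    may tend to 0. *)
Lemma kern_integral_bound : exists2 M : R, 0 <= M &
  forall (n : nat) (lo hi K : R) (w : R -> R), lo <= hi -> 0 <= K ->
    {within `[lo, hi], continuous w} ->
    (forall y, lo <= y <= hi -> `|w y| <= K) ->
    `|\int[leb]_(y in `[lo, hi]) (w y * kern n.+1%:R lo hi y)| <= K * M.
Proof.
have [M M0 dM] := @dstep_bounded R.
exists (2 * M); first by rewrite mulr_ge0.
move=> n lo hi K w lohi K0 cw wK.
set N : R := n.+1%:R; have N0 : 0 < N by rewrite ltr0n.
clearbody N.
have [c1 c2] := kern_parts_continuous N lo hi.
set k1 := (fun y => _) in c1; set k2 := (fun y => _) in c2.
have ci f : continuous f -> {within `[lo, hi], continuous (fun y : R => w y * f y)}.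
  move=> cf y; apply: cvgM; first exact: cw.
  by apply: continuous_subspaceT; exact: cf.
have i1 := continuous_itv_integrable (ci _ c1).
have i2 := continuous_itv_integrable (ci _ c2).
have -> : \int[leb]_(y in `[lo, hi]) (w y * kern N lo hi y) =
    \int[leb]_(y in `[lo, hi]) (w y * k1 y) - \int[leb]_(y in `[lo, hi]) (w y * k2 y).
  rewrite -RintegralB//; apply: eq_Rintegral => y _.
  by rewrite /kern /k1 /k2 mulrBr.
have step_norm t : `|@step R t| <= 1 by rewrite ger0_norm ?step_ge0// step_le1.
rewrite (_ : K * (2 * M) = K * M + K * M); last by ring.
apply: le_trans (ler_normB _ _) _; apply: lerD.
(* Height times width: [dstep (N * (y - lo))] is nonzero only for y between lo + 1/N and lo +
   2/N. *)
- have -> : K * M = K * (N * M) * ((lo + 2 / N) - (lo + 1 / N)).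
    by rewrite mulrA -[RHS]mulrA -mulrA; field; rewrite gt_eqF.
  apply: kernel_bound => //.
  + by rewrite lerD2l ler_pM2r ?invr_gt0//; lra.
  + move=> y _ ny; rewrite /k1 dstep_eq0 ?(mulr0, mul0r)//.
    apply/negPn/negP; rewrite negb_or -!leNgt => /andP[h1 h2]; apply: ny.
    rewrite -lerBrDl ler_pdivrMr// mulrC; apply/andP; split; first lra.
    by rewrite -lerBlDl ler_pdivlMr// mulrC.
  + move=> y ylh _; apply: normrM_le; first by apply: wK; move: ylh; rewrite /= in_itv.
    by rewrite -[leRHS]mulr1; apply: normrM_le => //; apply: normrM_le => //; rewrite gtr0_norm.
  + by rewrite !mulr_ge0// ltW.
- have -> : K * M = K * (N * M) * ((hi - 1 / N) - (hi - 2 / N)).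
    by field; rewrite gt_eqF.
  apply: kernel_bound => //.
  + by rewrite lerD2l lerN2 ler_pM2r ?invr_gt0//; lra.
  + move=> y _ ny; rewrite /k2 dstep_eq0 ?(mulr0, mul0r)//.
    apply/negPn/negP; rewrite negb_or -!leNgt => /andP[h1 h2]; apply: ny.
    have {}h1 : 1 / N <= hi - y by rewrite ler_pdivrMr// mulrC.
    have {}h2 : hi - y <= 2 / N by rewrite ler_pdivlMr// mulrC.
    by apply/andP; split; lra.
  + move=> y ylh _; apply: normrM_le; first by apply: wK; move: ylh; rewrite /= in_itv.
    by rewrite -[N in leRHS]mulr1; apply: normrM_le => //; apply: normrM_le => //; rewrite gtr0_norm.
  + by rewrite !mulr_ge0// ltW.
Qed.

Lemma kern_bounded (N lo hi y M : R) : 0 < N -> (forall t : R, `|dstep t| <= M) ->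
  `|kern N lo hi y| <= 2 * (N * M).
Proof.
move=> N0 dM; have step_norm t : `|@step R t| <= 1 by rewrite ger0_norm ?step_ge0// step_le1.
rewrite /kern; apply: le_trans (ler_normB _ _) _.
rewrite mulrDl mul1r; apply: lerD.
  by rewrite -[leRHS]mulr1; apply: normrM_le => //; apply: normrM_le => //; rewrite gtr0_norm.
by rewrite -[N in leRHS]mulr1; apply: normrM_le => //; apply: normrM_le => //; rewrite gtr0_norm.
Qed.

(* [kern] concentrates, with total mass 1 and -1, at the two ends. *)
Lemma kern_limit (lo hi : R) (w : R -> R) : lo < hi ->
  {within `[lo, hi], continuous w} ->
  (fun n => \int[leb]_(y in `[lo, hi]) (w y * kern n.+1%:R lo hi y)) @ \oo
    --> w lo - w hi.
Proof.
move=> lohi cw.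
have [M M0 dM] := @dstep_bounded R.
have [_ wlo whi] := (iffLR (continuous_within_itvP w lohi)) cw.
apply/cvgrPdist_le => e e0.
have M1 : 0 < 4 * (M + 1) by lra.
(* Each half of the interval will contribute an error of at most [d * (2 * (N * M)) / N], that is
   2dM, which this choice keeps below e/2; the added 1 avoids division by 0. *)
pose d : R := e / (4 * (M + 1)).
have e1 : 0 < d by rewrite divr_gt0.
have dE : d * (4 * (M + 1)) = e by rewrite divfK// gt_eqF.
clearbody d.
move/cvgrPdist_le : wlo => /(_ _ e1)[r1 /= r10 wlo].
move/cvgrPdist_le : whi => /(_ _ e1)[r2 /= r20 whi].
near=> n.
have n1 : 4 / r1 < n.+1%:R :> R by near: n; exact: nbhs_infty_gtr_S.
have n2 : 4 / r2 < n.+1%:R :> R by near: n; exact: nbhs_infty_gtr_S.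
have n3 : 4 / (hi - lo) < n.+1%:R :> R by near: n; exact: nbhs_infty_gtr_S.
set N : R := n.+1%:R in n1 n2 n3 *; have N0 : 0 < N by rewrite ltr0n.
clearbody N.
have Nlarge (r : R) : N > 4 / r -> 0 < r -> 4 / N < r.
  by move=> h r0; rewrite ltr_pdivrMr// mulrC -ltr_pdivrMr.
have N1 : 4 / N < r1 by exact: Nlarge.
have N2 : 4 / N < r2 by exact: Nlarge.
(* Each half of the interval is then longer than 2/N: both steps equal 1 at the midpoint, and each
   half carries exactly one bump, of total mass exactly 1 or -1. *)
have N3 : 4 / N < hi - lo.
  by apply: Nlarge; rewrite ?subr_gt0.
have Ni : 0 < N^-1 by rewrite invr_gt0.
set mid := (lo + hi) / 2.
have lm : lo < mid by rewrite /mid; lra.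
have mh : mid < hi by rewrite /mid; lra.
have ck := @kern_continuous R N lo hi.
have ci f a b : `[a, b] `<=` `[lo, hi] -> continuous f ->
    {within `[a, b], continuous (fun y => w y * f y)}.
  move=> ab cf y; apply: cvgM.
    by move: y; exact: continuous_subspaceW cw.
  by apply: continuous_subspaceT; exact: cf.
have s1 : `[lo, mid] `<=` `[lo, hi].
  by move=> y; rewrite /= !in_itv/= => /andP[-> /le_trans->]//; exact: ltW.
have s2 : `[mid, hi] `<=` `[lo, hi].
  by move=> y; rewrite /= !in_itv/= => /andP[my ->]; rewrite (le_trans _ my)// ltW.
have ik := continuous_itv_integrable (ci _ _ _ (@subset_refl _ _) ck).
have ik1 := continuous_itv_integrable (ci _ _ _ s1 ck).
have ik2 := continuous_itv_integrable (ci _ _ _ s2 ck).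
have cst_int a b (c : R) : leb.-integrable `[a, b] (EFin \o (fun y => c * kern N lo hi y)).
  apply: continuous_itv_integrable; apply: continuous_subspaceT => y.
  by apply: cvgM; [exact: cvg_cst|exact: ck].
have kint a b : leb.-integrable `[a, b] (EFin \o kern N lo hi).
  by apply: continuous_itv_integrable; exact: continuous_subspaceT.
have kernN y : `|kern N lo hi y| <= 2 * (N * M) by exact: kern_bounded.
have E : \int[leb]_(y in `[lo, hi]) (w y * kern N lo hi y) =
   \int[leb]_(y in `[lo, mid]) (w y * kern N lo hi y) +
   \int[leb]_(y in `[mid, hi]) (w y * kern N lo hi y).
  have := @Rintegral_itvB R (fun y => w y * kern N lo hi y) (BLeft lo) (BRight hi) mid ik.
  rewrite !bnd_simp => /(_ (ltW lm) (ltW mh)) h.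
  rewrite -(@Rintegral_itv_obnd_cbnd R mid (BRight hi)) -?h; first by ring.
  apply: integrableS ik2 => //; apply: subset_itvr; by rewrite bnd_simp.
rewrite E.
have I1 : \int[leb]_(y in `[lo, mid]) kern N lo hi y = 1.
  rewrite integral_kern// subrr mulr0 (@step_eq0 _ 0) ?ler01// mul0r subr0.
  by rewrite !step_eq1 ?mulr1// /mid mulrC -ler_pdivrMr//; clear -N3; lra.
have I2 : \int[leb]_(y in `[mid, hi]) kern N lo hi y = -1.
  rewrite integral_kern// subrr mulr0 (@step_eq0 _ 0) ?ler01// mulr0 sub0r.
  by rewrite !step_eq1 ?mulr1// /mid mulrC -ler_pdivrMr//; clear -N3; lra.
have part a b (c : R) : `[a, b] `<=` `[lo, hi] ->
    leb.-integrable `[a, b] (EFin \o (fun y => w y * kern N lo hi y)) ->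
    \int[leb]_(y in `[a, b]) (w y * kern N lo hi y) -
    c * \int[leb]_(y in `[a, b]) kern N lo hi y =
    \int[leb]_(y in `[a, b]) ((w y - c) * kern N lo hi y).
  move=> ab iab; rewrite -RintegralZl// -RintegralB//.
  by apply: eq_Rintegral => y _; rewrite mulrBl.
have P1 := part _ _ (w lo) s1 ik1; rewrite I1 mulr1 in P1.
have P2 := part _ _ (w hi) s2 ik2; rewrite I2 mulrN1 in P2.
have iB a b c : leb.-integrable `[a, b] (EFin \o (fun y => w y * kern N lo hi y)) ->
   leb.-integrable `[a, b] (EFin \o (fun y => (w y - c) * kern N lo hi y)).
  move=> i; have := integrableB _ i (cst_int a b c) => /(_ ltac:(by [])).
  by apply: eq_integrable => // y _ /=; rewrite -EFinB mulrBl.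
have C0 : 0 <= d * (2 * (N * M)).
  by rewrite mulr_ge0 ?(ltW e1)// mulr_ge0// mulr_ge0// ltW.
have B0 : d * (2 * (N * M)) / N <= e / 2.
  have -> : d * (2 * (N * M)) / N = d * (2 * M) by field; rewrite gt_eqF.
  by rewrite -dE; clear -e1; lra.
have B1 : `|\int[leb]_(y in `[lo, mid]) ((w y - w lo) * kern N lo hi y)| <= e / 2.
  apply: le_trans B0.
  have -> : N^-1 = (lo + 2 / N) - (lo + 1 / N) by field; rewrite gt_eqF.
  apply: kernel_bound => //.
  - by rewrite lerD2l ler_pM2r//; clear; lra.
  - exact: iB.
  - move=> y; rewrite /= in_itv/= => /andP[ly ym] ny.
    have h : 2 < N * (hi - y) by rewrite mulrC -ltr_pdivrMr//; rewrite /mid in ym; clear -ym N3; lra.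
    rewrite /kern (@dstep_eq0 _ (N * (hi - y))) ?h ?orbT// mulr0 subr0.
    rewrite dstep_eq0 ?mulr0 ?mul0r ?mulr0//.
    apply/negPn/negP; rewrite negb_or -!leNgt => /andP[h1 h2]; apply: ny.
    have {}h1 : 1 / N <= y - lo by rewrite ler_pdivrMr// mulrC.
    have {}h2 : y - lo <= 2 / N by rewrite ler_pdivlMr// mulrC.
    by clear -h1 h2; apply/andP; split; lra.
  - move=> y _ /andP[h1 h2]; apply: normrM_le => //.
    rewrite distrC; apply: wlo; last by clear -h1 Ni; lra.
    by clear -h1 h2 N1 Ni; rewrite /= distrC ger0_norm; lra.
have B2 : `|\int[leb]_(y in `[mid, hi]) ((w y - w hi) * kern N lo hi y)| <= e / 2.
  apply: le_trans B0.
  have -> : N^-1 = (hi - 1 / N) - (hi - 2 / N) by field; rewrite gt_eqF.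
  apply: kernel_bound => //.
  - by rewrite lerD2l lerN2 ler_pM2r//; clear; lra.
  - exact: iB.
  - move=> y; rewrite /= in_itv/= => /andP[my yh] ny.
    have h : 2 < N * (y - lo) by rewrite mulrC -ltr_pdivrMr//; rewrite /mid in my; clear -my N3; lra.
    rewrite /kern (@dstep_eq0 _ (N * (y - lo))) ?h ?orbT// mulr0 mul0r sub0r.
    rewrite dstep_eq0 ?mulr0 ?oppr0 ?mulr0//.
    apply/negPn/negP; rewrite negb_or -!leNgt => /andP[h1 h2]; apply: ny.
    have {}h1 : 1 / N <= hi - y by rewrite ler_pdivrMr// mulrC.
    have {}h2 : hi - y <= 2 / N by rewrite ler_pdivlMr// mulrC.
    by clear -h1 h2; apply/andP; split; lra.
  - move=> y _ /andP[h1 h2]; apply: normrM_le => //.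
    rewrite distrC; apply: whi; last by clear -h2 Ni; lra.
    by clear -h1 h2 N2 Ni; rewrite /= ger0_norm; lra.
rewrite -P1 in B1; rewrite -P2 in B2.
move: B1 B2; rewrite !ler_norml => /andP[b1 b1'] /andP[b2 b2'].
by clear -b1 b1' b2 b2'; apply/andP; split; lra.
Unshelve. all: by end_near. Qed.

End strip.

(** * Integration in the plane *)

Section plane_measure.
Context {R : realType}.
Notation leb := (@lebesgue_measure R).
Notation plane := (measurableTypeR R * measurableTypeR R)%type.

Lemma affine_continuous (a b c : R) :
  continuous (fun p : R * R => a * p.1 + b * p.2 + c).
Proof.
move=> x; apply: cvgD; last exact: cvg_cst.
by apply: cvgD; apply: cvgM; try exact: cvg_cst; [exact: cvg_fst|exact: cvg_snd].
Qed.

Lemma affine_measurable (a b c : R) :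
  measurable_fun [set: plane] (fun p : plane => (a * p.1 + b * p.2 + c : R)).
Proof.
apply: measurable_funD; last exact: measurable_cst.
apply: measurable_funD; apply: measurable_funM; try exact: measurable_cst.
  exact: measurable_fst.
exact: measurable_snd.
Qed.

Lemma halfplane_open (a b c : R) :
  open [set p : R * R | 0 < a * p.1 + b * p.2 + c].
Proof.
apply: (@open_comp _ _ (fun p : R * R => a * p.1 + b * p.2 + c) [set t | 0 < t]).
  by move=> x _; exact: affine_continuous.
exact: open_gt.
Qed.

Lemma halfplane_closed (a b c : R) :
  closed [set p : R * R | 0 <= a * p.1 + b * p.2 + c].
Proof.
apply: (@closed_comp _ _ (fun p : R * R => a * p.1 + b * p.2 + c) [set t | 0 <= t]).
  by move=> x _; exact: affine_continuous.
exact: closed_ge.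
Qed.

Lemma halfplane_measurable (a b c : R) :
  measurable [set p : plane | 0 < a * p.1 + b * p.2 + c].
Proof.
have := @affine_measurable a b c measurableT [set t : R | 0 < t].
move=> h; rewrite -[X in measurable X]setTI; apply: h.
by apply: open_measurable; exact: open_gt.
Qed.

Lemma closed_halfplane_measurable (a b c : R) :
  measurable [set p : plane | 0 <= a * p.1 + b * p.2 + c].
Proof.
have := @affine_measurable a b c measurableT [set t : R | 0 <= t].
move=> h; rewrite -[X in measurable X]setTI; apply: h.
by apply: closed_measurable; exact: closed_ge.
Qed.

Lemma Rdominated_convergence d (T : measurableType d)
    (mu : {measure set T -> \bar R}) (D : set T)
    (f_ : nat -> T -> R) (f g : T -> R) :
  measurable D -> (forall n, measurable_fun D (f_ n)) ->
  (forall x, D x -> f_ ^~ x @ \oo --> f x) ->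
  mu.-integrable D (EFin \o g) ->
  (forall n x, D x -> `|f_ n x| <= g x) ->
  mu.-integrable D (EFin \o f) /\
  (fun n => \int[mu]_(x in D) f_ n x) @ \oo --> \int[mu]_(x in D) f x.
Proof.
move=> mD mf cf ig fg.
have mE n : measurable_fun D (fun x => (f_ n x)%:E) by apply/measurable_EFinP.
have cE x : D x -> (fun n => (f_ n x)%:E) @ \oo --> (f x)%:E.
  by move=> Dx; apply: cvg_EFin; [exact: nearW|exact: cf].
have [||||i _ c] := @dominated_convergence _ _ _ mu D mD (fun n x => (f_ n x)%:E)
   (EFin \o f) (EFin \o g) mE.
- exact: emeasurable_fun_cvg mE cE.
- exact/aeW.
- exact: ig.
- by apply/aeW => x n Dx /=; rewrite lee_fin fg.
split => //; rewrite /Rintegral; apply: fine_cvg.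
rewrite fineK; last exact: integrable_fin_num.
exact: c.
Qed.

(** The real-valued integral turns an infinite or undefined inner value into its [fine] part. This
    affects only a null set of abscissas, because the section integrals of an integrable function
    are finite almost everywhere. *)
Lemma Rfubini (F : plane -> R) : (@mu2 R).-integrable setT (EFin \o F) ->
  measurable_fun setT (fun x : measurableTypeR R => \int[leb]_y F (x, y)) /\
  \int[mu2]_p F p = \int[leb]_x (\int[leb]_y F (x, y)).
Proof.
move=> iF; have mF := measurable_fubini_F iF.
have iFF := integrable_fubini_F iF.
have mfF : measurable_fun setT (fine \o fubini_F leb (EFin \o F)).
  by apply: measurableT_comp => //; exact: fine_measurable.
split; first exact: mfF.
rewrite /Rintegral /mu2 -(integral12_prod_meas1 iF); congr fine.
apply: ae_eq_integral => //.
  exact/measurable_EFinP.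
have [N [mN N0 sN]] := integrable_ae measurableT iFF.
exists N; split => // x /= nx; apply: sN => /= h; apply: nx => _.
by rewrite fineK// h.
Qed.

Lemma mu2_box_lty (a b c d : R) :
  ((@mu2 R) (`[a, b]%classic `*` `[c, d]%classic) < +oo)%E.
Proof.
rewrite [X in (X < _)%E](_ : _ = leb `[a, b] * leb `[c, d])%E; last exact: product_measure1E.
by rewrite lte_mul_pinfty ?measure_ge0// ?ge0_fin_numE ?measure_ge0//;
  rewrite lebesgue_measure_itv/=; case: ifP => _; rewrite -?EFinB ltry.
Qed.

End plane_measure.

(** * Flux through a trapezoid *)

Section trapezoid.
Context {R : realType}.
Notation leb := (@lebesgue_measure R).
Notation plane := (measurableTypeR R * measurableTypeR R)%type.
Variables (x0 x1 m q m' q' : R).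
Let lo x := m * x + q.
Let hi x := m' * x + q'.

Definition trap : set (R * R) :=
  [set p | [/\ x0 < p.1, p.1 < x1, m * p.1 + q < p.2 & p.2 < m' * p.1 + q']].

Lemma trapE : trap =
  [set p | 0 < 1 * p.1 + 0 * p.2 + - x0] `&`
  [set p | 0 < -1 * p.1 + 0 * p.2 + x1] `&`
  [set p | 0 < - m * p.1 + 1 * p.2 + - q] `&`
  [set p | 0 < m' * p.1 + -1 * p.2 + q'].
Proof.
apply/seteqP; split => p /=.
  by move=> [h1 h2 h3 h4]; do !split; lra.
by move=> [[[h1 h2] h3] h4]; split; lra.
Qed.

Lemma trap_open : open trap.
Proof. by rewrite trapE; do ! apply: openI; exact: halfplane_open. Qed.

Lemma trap_measurable : measurable (trap : set plane).
Proof. by rewrite trapE; do ! apply: measurableI; exact: halfplane_measurable. Qed.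

Definition cutoff (N : R) (p : R * R) : R :=
  step (N * (p.1 - x0)) * step (N * (x1 - p.1)) *
  (step (N * (p.2 - lo p.1)) * step (N * (hi p.1 - p.2))).

Lemma smooth_step_affine (f : R * R -> R) (a b c : R) :
  (forall p, f p = a * p.1 + b * p.2 + c) -> smooth (fun p => step (f p)).
Proof.
move=> fE; have -> : f = (fun p => a * p.1 + b * p.2 + c) by apply/funext.
exact: smooth_step.
Qed.

Lemma cutoff_smooth N : smooth (cutoff N).
Proof.
apply: smoothM; apply: smoothM.
- by apply: (@smooth_step_affine _ N 0 (- (N * x0))) => p; ring.
- by apply: (@smooth_step_affine _ (- N) 0 (N * x1)) => p; ring.
- by apply: (@smooth_step_affine _ (- (N * m)) N (- (N * q))) => p; rewrite /lo; ring.
- by apply: (@smooth_step_affine _ (N * m') (- N) (N * q')) => p; rewrite /hi; ring.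
Qed.

Lemma cutoff_ge0 N p : 0 <= cutoff N p.
Proof. by apply: mulr_ge0; apply: mulr_ge0; exact: step_ge0. Qed.

Lemma cutoff_le1 N p : cutoff N p <= 1.
Proof. have h (a b : R) : 0 <= step a * step b <= 1.
  by apply/andP; split; [apply: mulr_ge0|apply: mulr_ile1]; rewrite ?step_ge0 ?step_le1.
have /andP[? ?] := h (N * (p.1 - x0)) (N * (x1 - p.1)).
have /andP[? ?] := h (N * (p.2 - lo p.1)) (N * (hi p.1 - p.2)).
exact: mulr_ile1. Qed.

(** A compact subset of the open trapezoid that contains the support of the cutoff: a margin 1/N is
    kept since [step] vanishes up to 1. *)
Definition shrink (N : R) : set (R * R) :=
  [set p | [/\ x0 + N^-1 <= p.1, p.1 <= x1 - N^-1,
               lo p.1 + N^-1 <= p.2 & p.2 <= hi p.1 - N^-1]].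

Lemma cutoff_shrink N p : 0 < N -> cutoff N p != 0 -> shrink N p.
Proof.
move=> N0; have NN : N * N^-1 = 1 by rewrite mulfV// gt_eqF.
have st (t : R) : step (N * t) != 0 -> N^-1 <= t.
  move=> h; rewrite leNgt; apply/negP => tN; move/negP: h; apply.
  by rewrite step_eq0// -NN ler_pM2l// ltW.
have nz (a b c d : R) : a * b * (c * d) != 0 -> [/\ a != 0, b != 0, c != 0 & d != 0].
  by rewrite !mulf_eq0 !negb_or => /andP[/andP[-> ->] /andP[-> ->]].
move=> /nz[h1 h2 h3 h4]; move: (st _ h1) (st _ h2) (st _ h3) (st _ h4) => {h1 h2 h3 h4} *; by split; lra.
Qed.

Lemma shrink_closed N : closed (shrink N).
Proof.
rewrite (_ : shrink N =
  [set p | 0 <= 1 * p.1 + 0 * p.2 + - (x0 + N^-1)] `&`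
  [set p | 0 <= -1 * p.1 + 0 * p.2 + (x1 - N^-1)] `&`
  [set p | 0 <= - m * p.1 + 1 * p.2 + - (q + N^-1)] `&`
  [set p | 0 <= m' * p.1 + -1 * p.2 + (q' - N^-1)]).
  by do ! apply: closedI; exact: halfplane_closed.
apply/seteqP; split => p /=; rewrite /shrink/= /lo /hi.
  by move=> [h1 h2 h3 h4]; do !split; lra.
by move=> [[[h1 h2] h3] h4]; split; lra.
Qed.

Lemma affine_bounded (k c x : R) : x0 <= x <= x1 ->
  `|k * x + c| <= `|k| * (`|x0| + `|x1|) + `|c|.
Proof.
move=> /andP[h0 h1]; apply: le_trans (ler_normD _ _) _; rewrite lerD2r normrM.
apply: ler_wpM2l => //; rewrite ler_norml; apply/andP; split.
  by have := ler_norm (- x0); have := normr_ge0 x1; rewrite normrN; lra.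
by have := ler_norm x1; have := normr_ge0 x0; lra.
Qed.

Lemma shrink_compact N : 0 < N -> compact (shrink N).
Proof.
move=> N0.
pose B (c k : R) : R := `|k| * (`|x0| + `|x1|) + `|c|.
apply: (@subclosed_compact _ _ (`[x0, x1]%classic `*` `[- B q m, B q' m']%classic)).
- exact: shrink_closed.
- by apply: compact_setX; exact: segment_compact.
move=> p [h1 h2 h3 h4]; have Ni : 0 < N^-1 by rewrite invr_gt0.
have hx : x0 <= p.1 <= x1 by apply/andP; split; lra.
have := affine_bounded m q hx; have := affine_bounded m' q' hx.
rewrite !ler_norml -/(lo p.1) -/(hi p.1) => /andP[b1 b2] /andP[b3 b4].
by split; rewrite /= in_itv/= /B; apply/andP; split; lra.
Qed.

Lemma shrink_trap N : 0 < N -> shrink N `<=` trap.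
Proof.
move=> N0 p [h1 h2 h3 h4]; have Ni : 0 < N^-1 by rewrite invr_gt0.
by rewrite /lo /hi in h3 h4; split; lra.
Qed.

Lemma cutoff_test_function N : 0 < N -> test_function trap (cutoff N).
Proof.
move=> N0; have s : closure [set p | cutoff N p != 0] `<=` shrink N.
  by rewrite closureE => p; apply; split; [exact: shrink_closed|
     move=> r /=; exact: cutoff_shrink].
split.
- by move=> n; exact/smooth_Ck/cutoff_smooth.
- apply: (subclosed_compact _ (shrink_compact N0) s); exact: closed_closure.
- exact: subset_trans s (shrink_trap N0).
Qed.

(** The factors attached to the vertical sides do not depend on the ordinate, so on each section
    only the one-dimensional kernel is left. *)
Lemma partial_cutoff N p : partial 1 (cutoff N) p =
  step (N * (p.1 - x0)) * step (N * (x1 - p.1)) *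
  kern N (lo p.1) (hi p.1) p.2.
Proof.
rewrite /partial; suff: is_derive p (basis2 1) (cutoff N)
  (step (N * (p.1 - x0)) * step (N * (x1 - p.1)) * kern N (lo p.1) (hi p.1) p.2).
  by case.
apply/is_derive_line.
set b := step _ * _.
have d := @is_derive_kern R N (lo p.1) (hi p.1) p.2.
have /is_derive_line d' := d.
apply: (is_derive_congr (is_deriveZ b d')); [move=> h|reflexivity].
have -> : h *: basis2 1 + p = (p.1, h *: 1 + p.2).
  have -> : @basis2 R 1 = (0, 1) by [].
  by rewrite [LHS]surjective_pairing /=; congr (_, _); rewrite ?scaler0 ?add0r.
by [].
Qed.

Lemma cutoff_eq1 p : trap p -> \forall n \near \oo, cutoff n.+1%:R p = 1.
Proof.
move=> [h1 h2 h3 h4].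
have st (t : R) : 0 < t -> \forall n \near \oo, step (n.+1%:R * t) = 1.
  move=> t0; near=> n; apply: step_eq1; rewrite -ler_pdivrMr// ltW//.
  by near: n; exact: nbhs_infty_gtr_S.
near=> n; rewrite /cutoff.
have -> : step (n.+1%:R * (p.1 - x0)) = 1.
  by near: n; apply: st; rewrite subr_gt0.
have -> : step (n.+1%:R * (x1 - p.1)) = 1.
  by near: n; apply: st; rewrite subr_gt0.
have -> : step (n.+1%:R * (p.2 - lo p.1)) = 1.
  by near: n; apply: st; rewrite subr_gt0.
have -> : step (n.+1%:R * (hi p.1 - p.2)) = 1.
  by near: n; apply: st; rewrite subr_gt0.
by rewrite !mul1r.
Unshelve. all: by end_near. Qed.

Lemma cutoff_out N p : 0 < N -> ~ trap p -> cutoff N p = 0.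
Proof.
move=> N0 np; apply/eqP; apply/negPn/negP => /(cutoff_shrink N0)/(shrink_trap N0).
exact: np.
Qed.

Lemma integral_mul_cutoff (g : R * R -> R) :
  (@mu2 R).-integrable setT (EFin \o g) ->
  (fun n => \int[mu2]_p (g p * cutoff n.+1%:R p)) @ \oo -->
  \int[mu2]_(p in trap) g p.
Proof.
move=> ig; rewrite Rintegral_mkcond.
have N0 n : (0 : R) < n.+1%:R by rewrite ltr0n.
have mg : measurable_fun [set: plane] g by apply/measurable_EFinP; exact: measurable_int ig.
have [] := @Rdominated_convergence R _ _ (@mu2 R) setT
  (fun n p => g p * cutoff n.+1%:R p) (g \_ trap) (fun p => `|g p|) => //.
- move=> n; apply: measurable_funM => //.
  exact: smooth_measurable (cutoff_smooth _).
- move=> p _; have [tp|ntp] := pselect (trap p).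
    rewrite patchE mem_set//; apply: cvg_near_cst.
    by apply: filterS (cutoff_eq1 tp) => n ->; rewrite mulr1.
  rewrite patchE memNset//; apply: cvg_near_cst; apply: nearW => n.
  by rewrite cutoff_out ?mulr0.
- exact: (integrable_abse ig).
- move=> n p _; rewrite normrM -[leRHS]mulr1; apply: ler_wpM2l => //.
  by rewrite ger0_norm ?cutoff_ge0 ?cutoff_le1.
Qed.

End trapezoid.

(** * Passage to the limit in the cutoffs *)

Section flux.
Context {R : realType}.
Notation leb := (@lebesgue_measure R).
Notation plane := (measurableTypeR R * measurableTypeR R)%type.

(* Testing the weak y-derivative g of u against a cutoff of the trapezoid and
   letting the cutoff tend to 1. *)
Lemma trapezoid_flux (x0 x1 m q m' q' K : R) (u g : R * R -> R) :
  (forall x, x0 < x < x1 -> m * x + q < m' * x + q') ->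
  (@mu2 R).-integrable setT (EFin \o u) ->
  (@mu2 R).-integrable setT (EFin \o g) ->
  (forall x, x0 < x < x1 ->
    {within `[m * x + q, m' * x + q'], continuous (fun y => u (x, y))}) ->
  (forall x y, x0 < x < x1 -> m * x + q <= y <= m' * x + q' -> `|u (x, y)| <= K) ->
  (forall psi, smooth psi -> test_function (trap x0 x1 m q m' q') psi ->
    \int[mu2]_p (u p * partial 1 psi p) = - \int[mu2]_p (g p * psi p)) ->
  \int[mu2]_(p in trap x0 x1 m q m' q') g p =
  \int[leb]_(x in `]x0, x1[) (u (x, m' * x + q') - u (x, m * x + q)).
Proof.
move=> lohi iu ig cu uK weak.
pose lo x := m * x + q; pose hi x := m' * x + q'.
pose psi n := cutoff x0 x1 m q m' q' n.+1%:R.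
pose F n p := u p * partial 1 (psi n) p.
have N0 n : (0 : R) < n.+1%:R by rewrite ltr0n.
have [M0 M00 dM] := @dstep_bounded R.
have [M M_ge0 IM] := @kern_integral_bound R.
have step_norm t : `|@step R t| <= 1 by rewrite ger0_norm ?step_ge0// step_le1.
have mpart n : measurable_fun [set: plane] (partial 1 (psi n)).
  have [dg sdg ddg] := smooth_derive (basis2 1) (cutoff_smooth x0 x1 m q m' q' n.+1%:R).
  suff -> : partial 1 (psi n) = dg by exact: smooth_measurable.
  by apply/funext => p; rewrite /partial; have [] := ddg p.
have iF n : (@mu2 R).-integrable setT (EFin \o F n).
  apply: (@integrableMl _ _ _ (@mu2 R) setT measurableT (EFin \o u) _ iu (mpart n)).
  exists (2 * (n.+1%:R * M0)); split; first exact: num_real.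
  move=> C ltC p _ /=; apply: le_trans (ltW ltC).
  rewrite partial_cutoff -[leRHS]mul1r; apply: normrM_le; last exact: kern_bounded.
  by rewrite -[leRHS]mulr1; apply: normrM_le.
pose I n x := \int[leb]_y F n (x, y).
have mI n : measurable_fun setT (I n : measurableTypeR R -> R) by have [] := Rfubini (iF n).
have IE n : \int[mu2]_p F n p = \int[leb]_x I n x by have [] := Rfubini (iF n).
have I0 n x : ~ (x0 < x < x1) -> I n x = 0.
  move=> nx; rewrite /I (_ : (fun y => F n (x, y)) = cst 0) ?Rintegral_cst ?mul0r//.
  apply/funext => y; rewrite /F partial_cutoff /=.
  move/negP: nx; rewrite negb_and -!leNgt => /orP[xx|xx].
    rewrite (@step_eq0 _ (n.+1%:R * (x - x0))) ?mul0r ?mulr0//.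
    by apply: le_trans ler01; rewrite pmulr_rle0// subr_le0.
  rewrite (@step_eq0 _ (n.+1%:R * (x1 - x))) ?mul0r ?mulr0 ?mul0r ?mulr0//.
  by apply: le_trans ler01; rewrite pmulr_rle0// subr_le0.
have II n x : x0 < x < x1 -> I n x =
    step (n.+1%:R * (x - x0)) * step (n.+1%:R * (x1 - x)) *
    \int[leb]_(y in `[lo x, hi x]) (u (x, y) * kern n.+1%:R (lo x) (hi x) y).
  move=> xx; rewrite -RintegralZl//; last first.
    apply: continuous_itv_integrable => y; apply: cvgM; first exact: cu.
    by apply: continuous_subspaceT; exact: kern_continuous.
  rewrite /I (@Rintegral_restrict R _ _ leb setT `[lo x, hi x]%classic)//.
    by apply: eq_Rintegral => y _; rewrite /F partial_cutoff /=; ring.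
  move=> y _; rewrite /= in_itv/= => /negP; rewrite negb_and -!ltNge => ylh.
  rewrite /F partial_cutoff /= (_ : kern _ _ _ _ = 0) ?mulr0//.
  rewrite /kern; case/orP: ylh => yy.
    rewrite (@step_eq0 _ (n.+1%:R * (y - (m * x + q)))); last first.
      by apply: le_trans ler01; rewrite pmulr_rle0// subr_le0 ltW.
    rewrite (@dstep_eq0 _ (n.+1%:R * (y - (m * x + q)))) ?mulr0 ?mul0r ?subrr//.
    by rewrite (lt_trans _ ltr01)// pmulr_rlt0// subr_lt0.
  rewrite (@step_eq0 _ (n.+1%:R * (m' * x + q' - y))); last first.
    by apply: le_trans ler01; rewrite pmulr_rle0// subr_le0 ltW.
  rewrite (@dstep_eq0 _ (n.+1%:R * (m' * x + q' - y))) ?mulr0 ?mul0r ?subrr//.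
  by rewrite (lt_trans _ ltr01)// pmulr_rlt0// subr_lt0.
have IE' n : \int[leb]_x I n x = \int[leb]_(x in `]x0, x1[) I n x.
  apply: Rintegral_restrict => // x _; rewrite /= in_itv/=; exact: I0.
have cI x : x0 < x < x1 -> (fun n => I n x) @ \oo --> u (x, lo x) - u (x, hi x).
  move=> xx; have /andP[xx0 xx1] := xx.
  have st (t : R) : 0 < t -> \forall n \near \oo, step (n.+1%:R * t) = 1.
    move=> t0; near=> n; apply: step_eq1; rewrite -ler_pdivrMr// ltW//.
    by near: n; exact: nbhs_infty_gtr_S.
  have kl := kern_limit (lohi x xx) (cu x xx).
  apply: cvg_trans kl; apply: near_eq_cvg; near=> n; rewrite II//.
  have -> : step (n.+1%:R * (x - x0)) = 1.
    by near: n; apply: st; rewrite subr_gt0.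
  have -> : step (n.+1%:R * (x1 - x)) = 1.
    by near: n; apply: st; rewrite subr_gt0.
  by rewrite !mul1r.
have [idct dct] : leb.-integrable `]x0, x1[ (EFin \o (fun x => u (x, lo x) - u (x, hi x))) /\
   (fun n => \int[leb]_(x in `]x0, x1[) I n x) @ \oo -->
   \int[leb]_(x in `]x0, x1[) (u (x, lo x) - u (x, hi x)).
  (* A constant dominates, thanks to the uniformity of [kern_integral_bound]. [Num.max K 0] is taken
     because nothing forces [K] to be nonnegative when the interval is empty. *)
  apply: (@Rdominated_convergence R _ _ leb _ I _ (cst (Num.max K 0 * M))) => //.
  - by move=> n; apply: measurable_funTS; exact: mI.
  - apply: measurable_bounded_integrable => //.
      have h : (leb (`]x0, x1[%classic : set R) < +oo)%E.
        by rewrite lebesgue_measure_itv/=; case: ifP => _; rewrite -?EFinB ltry.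
      exact: h.
    exists (Num.max K 0 * M); split; first exact: num_real.
    move=> C ltC x _ /=; apply: le_trans (ltW ltC).
    by rewrite ger0_norm// mulr_ge0// le_max lexx orbT.
  - move=> n x; rewrite /= in_itv/= => xx; rewrite II// -[leRHS]mul1r.
    apply: normrM_le; first by rewrite -[leRHS]mulr1; apply: normrM_le.
    apply: IM; first exact/ltW/lohi.
    + by rewrite le_max lexx orbT.
    + exact: cu.
    + by move=> y yy; rewrite le_max uK.
(* The same sequence gets two limits, one from Fubini and the kernels, one from the weak identity;
   uniqueness of limits identifies them. *)
have lim1 : (fun n => \int[mu2]_p F n p) @ \oo -->
   \int[leb]_(x in `]x0, x1[) (u (x, lo x) - u (x, hi x)).
  by under eq_fun do rewrite IE IE'.
have lim2 : (fun n => \int[mu2]_p F n p) @ \oo -->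
    - \int[mu2]_(p in trap x0 x1 m q m' q') g p.
  have -> : (fun n => \int[mu2]_p F n p) = (fun n => - \int[mu2]_p (g p * psi n p)).
    by apply/funext => n; rewrite /F weak//; [exact: cutoff_smooth|exact: cutoff_test_function].
  by apply: cvgN; exact: integral_mul_cutoff.
have E := @cvg_unique _ (@Rhausdorff R) _ _ _ _ lim1 lim2.
rewrite -[LHS]opprK -E.
rewrite -mulN1r -RintegralZl//.
by apply: eq_Rintegral => x _; rewrite mulN1r opprB.
Unshelve. all: by end_near. Qed.

End flux.

(** * Triangles *)

Section triangles.
Context {R : realType}.
Notation leb := (@lebesgue_measure R).
Notation plane := (measurableTypeR R * measurableTypeR R)%type.
Implicit Types (a b c p P Q : R * R) (w f : R * R -> R).

(* Twice the signed area of the triangle a b c. *)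
Definition orient a b c : R :=
  (b.1 - a.1) * (c.2 - a.2) - (b.2 - a.2) * (c.1 - a.1).

Definition tri a b c : set (R * R) :=
  [set p | [/\ 0 <= orient a b p, 0 <= orient b c p & 0 <= orient c a p]].

Lemma tri_cycle a b c : tri a b c = tri b c a.
Proof. by apply/seteqP; split => p [h1 h2 h3]; split. Qed.

Lemma orient_cycle a b c : orient a b c = orient b c a.
Proof. rewrite /orient; ring. Qed.

Lemma orient_affine a b p :
  orient a b p = - (b.2 - a.2) * p.1 + (b.1 - a.1) * p.2 +
    ((b.2 - a.2) * a.1 - (b.1 - a.1) * a.2).
Proof. rewrite /orient; ring. Qed.

(** Together with the next two identities: the values of [orient] at p are the barycentric
    coordinates of p scaled by [orient a b c]. Convexity arguments on triangles thus avoid any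
    division. *)
Lemma orient_sum a b c p :
  orient a b p + orient b c p + orient c a p = orient a b c.
Proof. rewrite /orient; ring. Qed.

Lemma orient_bary1 a b c p :
  orient b c p * a.1 + orient c a p * b.1 + orient a b p * c.1 =
  orient a b c * p.1.
Proof. rewrite /orient; ring. Qed.

Lemma orient_bary2 a b c p :
  orient b c p * a.2 + orient c a p * b.2 + orient a b p * c.2 =
  orient a b c * p.2.
Proof. rewrite /orient; ring. Qed.

Lemma triE a b c : tri a b c =
  [set p | 0 <= orient a b p] `&` [set p | 0 <= orient b c p] `&`
  [set p | 0 <= orient c a p].
Proof. by apply/seteqP; split => p /= => [[]|[[]]]. Qed.

Lemma tri_closed a b c : closed (tri a b c).
Proof.
have h P Q : closed [set p | 0 <= orient P Q p].
  under eq_set do rewrite orient_affine; exact: halfplane_closed.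
by rewrite triE; do ! apply: closedI.
Qed.

Lemma tri_measurable a b c : measurable (tri a b c : set plane).
Proof.
have h P Q : measurable ([set p | 0 <= orient P Q p] : set plane).
  under eq_set do rewrite orient_affine; exact: closed_halfplane_measurable.
by rewrite triE; do ! apply: measurableI.
Qed.

(** A line that is not vertical meets every vertical section in one point; a vertical line is a
    product of a point with the real line, of measure 0 times infinity, which is 0. *)
Lemma line_null (a b c : R) : (a != 0) || (b != 0) ->
  (@mu2 R) [set p : plane | a * p.1 + b * p.2 + c = 0] = 0%E.
Proof.
move=> ab0; set L := [set p | _].
have xL x : b != 0 -> xsection L x = [set (- (a * x + c) / b)].
  move=> b0; apply/seteqP; split => y; rewrite /xsection/= inE /L /=.
    by move=> h; apply: (mulIf b0); rewrite divfK//; move: h; lra.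
  by move=> ->; field.
have [b0|b0] := eqVneq b 0; last first.
  rewrite /mu2 /= /product_measure1 /=.
  by apply: integral0_eq => x _ /=; rewrite xL// lebesgue_measure_set1.
have a0 : a != 0 by move: ab0; rewrite b0 eqxx orbF.
have -> : L = [set - c / a] `*` setT.
  apply/seteqP; split => p; rewrite /L /= b0 mul0r addr0.
    by move=> h; split => //; apply: (mulIf a0); rewrite divfK//; move: h; lra.
  by move=> [-> _]; field.
transitivity (leb [set (- c / a)%R] * leb setT)%E; last by rewrite lebesgue_measure_set1 mul0e.
exact: product_measure1E.
Qed.

(** For a vertical edge the division by 0 gives slope 0. This value is harmless: [line_integral]
    then runs over an empty interval. *)
Definition slope P Q : R := (Q.2 - P.2) / (Q.1 - P.1).
Definition icpt P Q : R := P.2 - slope P Q * P.1.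

Lemma orient_slope P Q p : P.1 < Q.1 ->
  orient P Q p = (Q.1 - P.1) * (p.2 - (slope P Q * p.1 + icpt P Q)).
Proof.
move=> PQ; rewrite /orient /icpt /slope.
by field; rewrite subr_eq0 gt_eqF.
Qed.

Lemma tri_left a b c p : 0 < orient a b c -> a.1 <= b.1 -> a.1 <= c.1 ->
  tri a b c p -> a.1 <= p.1.
Proof.
move=> o0 ab ac [h1 h2 h3]; rewrite -(ler_pM2l o0) -(orient_bary1 a b c p).
rewrite -subr_ge0 in ab; rewrite -subr_ge0 in ac.
have := mulr_ge0 h3 ab; have := mulr_ge0 h1 ac.
rewrite -(orient_sum a b c p); lra.
Qed.

Lemma tri_right a b c p : 0 < orient a b c -> a.1 <= c.1 -> b.1 <= c.1 ->
  tri a b c p -> p.1 <= c.1.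
Proof.
move=> o0 ac bc [h1 h2 h3]; rewrite -(ler_pM2l o0) -(orient_bary1 a b c p).
rewrite -subr_ge0 in ac; rewrite -subr_ge0 in bc.
have := mulr_ge0 h2 ac; have := mulr_ge0 h3 bc.
rewrite -(orient_sum a b c p); lra.
Qed.

Definition line_integral w P Q : R :=
  \int[leb]_(x in `]P.1, Q.1[) w (x, slope P Q * x + icpt P Q).

(* The oriented integral of w dx along the edge P Q: at least one of the two
   terms is an integral over the empty set. *)
Definition edge_flux w P Q : R := line_integral w P Q - line_integral w Q P.

Lemma edge_fluxC w P Q : edge_flux w P Q = - edge_flux w Q P.
Proof. by rewrite /edge_flux opprB. Qed.

Lemma line_integral0 w P Q : Q.1 <= P.1 -> line_integral w P Q = 0.
Proof.
move=> QP; rewrite /line_integral set_itv_ge ?Rintegral_set0//.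
by rewrite bnd_simp -leNgt.
Qed.

Lemma edge_flux_le w P Q : P.1 <= Q.1 -> edge_flux w P Q = line_integral w P Q.
Proof. by move=> PQ; rewrite /edge_flux (line_integral0 _ PQ) subr0. Qed.

(** The only analytic input of the triangle argument, isolated so that the argument serves both weak
    derivatives and the area. Trapezoids with [x0 >= x1] are allowed, so a triangle with a vertical
    side needs no separate treatment. *)
Definition vertical_flux f w (T : set (R * R)) :=
  forall x0 x1 m q m' q' : R,
  (forall x, x0 < x < x1 -> m * x + q < m' * x + q') ->
  trap x0 x1 m q m' q' `<=` T ->
  \int[mu2]_(p in trap x0 x1 m q m' q') f p =
  \int[leb]_(x in `]x0, x1[) (w (x, m' * x + q') - w (x, m * x + q)).

(** Allows the integral of a difference between two sides to be split into one integral per side. *)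
Definition line_integrable w (T : set (R * R)) :=
  forall x0 x1 m q : R, (forall x, x0 < x < x1 -> T (x, m * x + q)) ->
  leb.-integrable `]x0, x1[ (EFin \o (fun x => w (x, m * x + q))).

Lemma Rintegral_itv_split (f : R -> R) (x y z : R) : x <= y -> y <= z ->
  leb.-integrable `]x, z[ (EFin \o f) ->
  \int[leb]_(t in `]x, z[) f t =
  \int[leb]_(t in `]x, y[) f t + \int[leb]_(t in `]y, z[) f t.
Proof.
move=> xy; rewrite le_eqVlt => /orP[/eqP <-|yz] fi.
  by rewrite [X in _ + X](_ : _ = 0) ?addr0// set_itv_ge ?Rintegral_set0// bnd_simp ltxx.
have := @Rintegral_itvB R f (BRight x) (BLeft z) y fi.
rewrite !bnd_simp => /(_ xy yz) <-.
rewrite -(@Rintegral_itv_bndo_bndc R (BRight x)); first by ring.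
by apply: integrableS fi => //; apply: subset_itvl; rewrite bnd_simp ltW.
Qed.

Lemma Rintegral_null_diff (D N : set plane) f :
  measurable D -> measurable N -> (@mu2 R).-integrable D (EFin \o f) ->
  (@mu2 R) N = 0%E -> \int[mu2]_(p in D) f p = \int[mu2]_(p in D `\` N) f p.
Proof. by move=> mD mN fi N0; rewrite /Rintegral (negligible_integral mN mD fi N0). Qed.

Lemma orient_neq0 a b : a != b -> (- (b.2 - a.2) != 0) || (b.1 - a.1 != 0).
Proof.
move=> ab; rewrite -negb_and; apply: contra ab.
rewrite oppr_eq0 !subr_eq0 => /andP[/eqP h2 /eqP h1].
by rewrite [a]surjective_pairing [b]surjective_pairing h1 h2.
Qed.

Lemma edge_line_null a b : a != b ->
  measurable ([set p | orient a b p = 0] : set plane) /\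
  (@mu2 R) [set p | orient a b p = 0] = 0%E.
Proof.
move=> ab; split; last first.
  under eq_set do rewrite orient_affine; exact/line_null/orient_neq0.
have -> : [set p | orient a b p = 0] =
    [set p | 0 <= orient a b p] `&` [set p | 0 <= orient b a p].
  have ba p : orient b a p = - orient a b p by rewrite /orient; ring.
  apply/seteqP; split => p /=; rewrite ba; first by move=> ->; rewrite oppr0 lexx.
  by rewrite oppr_ge0 => -[h1 h2]; apply/eqP; rewrite eq_le h1 h2.
have h P Q : measurable ([set p | 0 <= orient P Q p] : set plane).
  under eq_set do rewrite orient_affine; exact: closed_halfplane_measurable.
exact: measurableI.
Qed.

Lemma vertical_line_null (t : R) :
  measurable ([set p | p.1 = t] : set plane) /\ (@mu2 R) [set p | p.1 = t] = 0%E.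
Proof.
have -> : [set p : plane | p.1 = t] = [set p | orient (t, 0) (t, 1) p = 0].
  apply/seteqP; split => p; rewrite /orient /= subrr mul0r subr0 mul1r sub0r.
    by move=> ->; rewrite subrr oppr0.
  by move/eqP; rewrite oppr_eq0 subr_eq0 => /eqP.
apply: edge_line_null; apply/eqP => -[] /eqP; rewrite eq_sym oner_eq0.
by [].
Qed.

(** The null set to discard: off the three side lines and the vertical lines through the vertices, a
    triangle is covered by two open trapezoids. *)
Definition tri_skeleton a b c : set (R * R) :=
  ([set p | orient a b p = 0] `|` [set p | orient b c p = 0] `|`
   [set p | orient c a p = 0]) `|`
  ([set p | p.1 = a.1] `|` [set p | p.1 = b.1] `|` [set p | p.1 = c.1]).

Lemma tri_skeleton_null a b c : 0 < orient a b c ->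
  measurable (tri_skeleton a b c : set plane) /\ (@mu2 R) (tri_skeleton a b c) = 0%E.
Proof.
move=> o0.
have ab : a != b by apply/eqP => h; move: o0; rewrite h /orient; lra.
have bc : b != c by apply/eqP => h; move: o0; rewrite h /orient; lra.
have ca : c != a by apply/eqP => h; move: o0; rewrite h /orient; lra.
have U (A B : set plane) : measurable A /\ (@mu2 R) A = 0%E ->
   measurable B /\ (@mu2 R) B = 0%E ->
   measurable (A `|` B) /\ (@mu2 R) (A `|` B) = 0%E.
  move=> [mA A0] [mB B0]; split; first exact: measurableU.
  by rewrite null_set_setU.
have v := vertical_line_null.
exact: (U _ _ (U _ _ (U _ _ (edge_line_null ab) (edge_line_null bc))
  (edge_line_null ca)) (U _ _ (U _ _ (v a.1) (v b.1)) (v c.1))).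
Qed.

(* To be applied with the vertical line x = x1 through the vertex of
   intermediate abscissa. *)
Lemma tri_flux_split a b c x1 m1 q1 m1' q1' m2 q2 m2' q2' x3 f :
  0 < orient a b c -> (@mu2 R).-integrable setT (EFin \o f) ->
  let D1 := trap a.1 x1 m1 q1 m1' q1' in let D2 := trap x1 x3 m2 q2 m2' q2' in
  D1 `<=` tri a b c -> D2 `<=` tri a b c ->
  tri a b c `\` tri_skeleton a b c `<=` D1 `|` D2 ->
  \int[mu2]_(p in tri a b c) f p =
  \int[mu2]_(p in D1) f p + \int[mu2]_(p in D2) f p.
Proof.
move=> o0 fi D1 D2 s1 s2 sT; have [mN N0] := tri_skeleton_null o0.
have mT := @tri_measurable a b c.
have mD1 : measurable (D1 : set plane) by exact: trap_measurable.
have mD2 : measurable (D2 : set plane) by exact: trap_measurable.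
have mD : measurable (D1 `|` D2 : set plane) by exact: measurableU.
have fiD (D : set plane) : measurable D -> (@mu2 R).-integrable D (EFin \o f).
  by move=> mD'; apply: integrableS fi.
rewrite (Rintegral_null_diff mT mN (fiD _ mT) N0).
have -> : tri a b c `\` tri_skeleton a b c = (D1 `|` D2) `\` tri_skeleton a b c.
  apply/seteqP; split => p [h nN]; split => //; first exact: sT.
  by case: h; [exact: s1|exact: s2].
rewrite -(Rintegral_null_diff mD mN (fiD _ mD) N0).
rewrite Rintegral_setU//; first exact: fiD.
apply/disj_setPS => p [] [_ h _ _] [h' _ _ _].
by move: (lt_trans h h'); rewrite ltxx.
Qed.

Lemma addr_mulM_ge0 (s t u v r : R) : 0 <= s -> 0 <= t -> 0 <= u -> 0 <= v -> 0 <= r ->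
  0 <= s * t + u * v * r.
Proof. by move=> *; rewrite addr_ge0// !mulr_ge0. Qed.

Lemma pmulr_eq_gt0 (t u v : R) : t * u = v -> 0 < u -> 0 < v -> 0 < t.
Proof. by move=> <- u0; rewrite pmulr_lgt0. Qed.

(** By orientation, b lies below the side a c. The vertical line through b cuts the triangle into
    trapezoids with the common upper line a c and the lower lines a b and b c; one of them is empty
    if b has the abscissa of a or c. *)
Lemma tri_flux_mid f w a b c : 0 < orient a b c -> a.1 <= b.1 -> b.1 <= c.1 ->
  (@mu2 R).-integrable setT (EFin \o f) ->
  vertical_flux f w (tri a b c) -> line_integrable w (tri a b c) ->
  \int[mu2]_(p in tri a b c) f p =
  - (edge_flux w a b + edge_flux w b c + edge_flux w c a).
Proof.
move=> o0 ab bc fi vf li; have ac := le_trans ab bc.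
have ac' : a.1 < c.1.
  rewrite lt_neqAle ac andbT; apply/eqP => h; move: o0.
  have hb : b.1 = a.1 by apply/eqP; rewrite eq_le ab h bc.
  by rewrite /orient hb -h !subrr mul0r mulr0 subrr ltxx.
have oc p : orient c a p = - ((c.1 - a.1) * (p.2 - (slope a c * p.1 + icpt a c))).
  by rewrite -orient_slope// /orient; ring.
have rhs : - (edge_flux w a b + edge_flux w b c + edge_flux w c a) =
    line_integral w a c - line_integral w a b - line_integral w b c.
  by rewrite (edge_fluxC w c a) !edge_flux_le//; ring.
pose L1 := trap a.1 b.1 (slope a b) (icpt a b) (slope a c) (icpt a c).
pose L2 := trap b.1 c.1 (slope b c) (icpt b c) (slope a c) (icpt a c).
have ac0 : 0 < c.1 - a.1 by rewrite subr_gt0.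
(* The side b c does not bound the left trapezoid; its inequality comes from writing a positive
   multiple of [orient b c] as a sum of two nonnegative terms. *)
have key1 (x y : R) : a.1 < x -> x < b.1 -> slope a b * x + icpt a b <= y ->
    0 <= orient b c (x, y).
  move=> ax xb yl; have ab' := lt_trans ax xb.
  have e : (b.1 - a.1) * orient b c (x, y) = (b.1 - x) * orient a b c +
      (b.1 - a.1) * (c.1 - b.1) * (y - (slope a b * x + icpt a b)).
    by rewrite /orient /icpt /slope /=; field; rewrite subr_eq0 gt_eqF.
  rewrite -(pmulr_rge0 _ (_ : 0 < b.1 - a.1)) ?subr_gt0// e.
  by apply: addr_mulM_ge0; rewrite ?(ltW o0)// subr_ge0// ltW.
have key2 (x y : R) : b.1 < x -> x < c.1 -> slope b c * x + icpt b c <= y ->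
    0 <= orient a b (x, y).
  move=> bx xc yl; have bc' := lt_trans bx xc.
  have e : (c.1 - b.1) * orient a b (x, y) = (x - b.1) * orient a b c +
      (b.1 - a.1) * (c.1 - b.1) * (y - (slope b c * x + icpt b c)).
    by rewrite /orient /icpt /slope /=; field; rewrite subr_eq0 gt_eqF.
  rewrite -(pmulr_rge0 _ (_ : 0 < c.1 - b.1)) ?subr_gt0// e.
  by apply: addr_mulM_ge0; rewrite ?(ltW o0)// subr_ge0// ltW.
have s1 (x y : R) : a.1 < x -> x < b.1 -> slope a b * x + icpt a b <= y ->
    y <= slope a c * x + icpt a c -> tri a b c (x, y).
  move=> ax xb yl yh; have ab' := lt_trans ax xb; split.
  - by rewrite orient_slope// mulr_ge0// subr_ge0// ltW.
  - exact: key1.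
  - by rewrite oc/= oppr_ge0 mulr_ge0_le0// ?subr_le0// ltW.
have s2 (x y : R) : b.1 < x -> x < c.1 -> slope b c * x + icpt b c <= y ->
    y <= slope a c * x + icpt a c -> tri a b c (x, y).
  move=> bx xc yl yh; have bc' := lt_trans bx xc; split.
  - exact: key2.
  - by rewrite orient_slope// mulr_ge0// subr_ge0// ltW.
  - by rewrite oc/= oppr_ge0 mulr_ge0_le0// ?subr_le0// ltW.
have lh1 (x : R) : a.1 < x < b.1 -> slope a b * x + icpt a b < slope a c * x + icpt a c.
  move=> /andP[ax xb]; have ab' := lt_trans ax xb.
  have e : (slope a c * x + icpt a c - (slope a b * x + icpt a b)) *
     ((b.1 - a.1) * (c.1 - a.1)) = (x - a.1) * orient a b c.
    by rewrite /orient /icpt /slope /=; field; rewrite !subr_eq0 !gt_eqF.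
  rewrite -subr_gt0; apply: pmulr_eq_gt0 e _ _; apply: mulr_gt0 => //;
    by rewrite subr_gt0.
have lh2 (x : R) : b.1 < x < c.1 -> slope b c * x + icpt b c < slope a c * x + icpt a c.
  move=> /andP[bx xc]; have bc' := lt_trans bx xc.
  have e : (slope a c * x + icpt a c - (slope b c * x + icpt b c)) *
     ((c.1 - b.1) * (c.1 - a.1)) = (c.1 - x) * orient a b c.
    by rewrite /orient /icpt /slope /=; field; rewrite !subr_eq0 !gt_eqF.
  rewrite -subr_gt0; apply: pmulr_eq_gt0 e _ _; apply: mulr_gt0 => //;
    by rewrite subr_gt0.
have t1 : L1 `<=` tri a b c.
  by move=> [x y] [/= *]; apply: s1 => //; exact: ltW.
have t2 : L2 `<=` tri a b c.
  by move=> [x y] [/= *]; apply: s2 => //; exact: ltW.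
have sT : tri a b c `\` tri_skeleton a b c `<=` L1 `|` L2.
  move=> p [Tp nN].
  have nz (P : Prop) : (P -> tri_skeleton a b c p) -> ~ P by move=> h /h.
  have n1 : orient a b p <> 0 by apply: nz => h; left; left; left.
  have n2 : orient b c p <> 0 by apply: nz => h; left; left; right.
  have n3 : orient c a p <> 0 by apply: nz => h; left; right.
  have n4 : p.1 <> a.1 by apply: nz => h; right; left; left.
  have n5 : p.1 <> b.1 by apply: nz => h; right; left; right.
  have n6 : p.1 <> c.1 by apply: nz => h; right; right.
  have lt0 (t : R) : t <> 0 -> 0 <= t -> 0 < t.
    by move=> /eqP t0 t0'; rewrite lt_neqAle eq_sym t0.
  have [/(lt0 _ n1) p1 /(lt0 _ n2) p2 /(lt0 _ n3) p3] := Tp.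
  have ax : a.1 < p.1.
    by rewrite lt_neqAle (tri_left o0 ab ac Tp) andbT eq_sym; exact/eqP.
  have xc : p.1 < c.1.
    by rewrite lt_neqAle (tri_right o0 ac bc Tp) andbT; exact/eqP.
  have hiP : p.2 < slope a c * p.1 + icpt a c.
    by move: p3; rewrite oc oppr_gt0 pmulr_rlt0// subr_lt0.
  have [xb|bx|//] := ltgtP p.1 b.1.
    left; split => //; move: p1; rewrite orient_slope; last exact: lt_trans ax xb.
    by rewrite pmulr_rgt0 ?subr_gt0// (lt_trans ax xb).
  right; split => //; move: p2; rewrite orient_slope; last exact: lt_trans bx xc.
  by rewrite pmulr_rgt0 ?subr_gt0// (lt_trans bx xc).
have il1 : leb.-integrable `]a.1, b.1[ (EFin \o (fun x => w (x, slope a b * x + icpt a b))).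
  by apply: li => x /[dup] /lh1 lh /andP[ax xb]; apply: s1 => //; exact: ltW.
have il2 : leb.-integrable `]b.1, c.1[ (EFin \o (fun x => w (x, slope b c * x + icpt b c))).
  by apply: li => x /[dup] /lh2 lh /andP[ax xb]; apply: s2 => //; exact: ltW.
have iu : leb.-integrable `]a.1, c.1[ (EFin \o (fun x => w (x, slope a c * x + icpt a c))).
  apply: li => x /andP[ax xc]; split.
  - have e : (c.1 - a.1) * orient a b (x, slope a c * x + icpt a c) =
      (x - a.1) * orient a b c.
      by rewrite /orient /icpt /slope /=; field; rewrite !subr_eq0 !gt_eqF.
    by rewrite -(pmulr_rge0 _ ac0) e mulr_ge0 ?(ltW o0)// subr_ge0 ltW.
  - have e : (c.1 - a.1) * orient b c (x, slope a c * x + icpt a c) =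
      (c.1 - x) * orient a b c.
      by rewrite /orient /icpt /slope /=; field; rewrite !subr_eq0 !gt_eqF.
    by rewrite -(pmulr_rge0 _ ac0) e mulr_ge0 ?(ltW o0)// subr_ge0 ltW.
  - by rewrite oc/= subrr mulr0 oppr0.
have iu1 : leb.-integrable `]a.1, b.1[ (EFin \o (fun x => w (x, slope a c * x + icpt a c))).
  by apply: integrableS iu => //; apply: subset_itvl; rewrite bnd_simp.
have iu2 : leb.-integrable `]b.1, c.1[ (EFin \o (fun x => w (x, slope a c * x + icpt a c))).
  by apply: integrableS iu => //; apply: subset_itvr; rewrite bnd_simp.
rewrite (tri_flux_split o0 fi t1 t2 sT) rhs !vf// !RintegralB// /line_integral.
rewrite (Rintegral_itv_split ab bc iu); ring.
Qed.

(** The mirror case: the middle vertex c lies above the side a b, which is now the common lower line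
    of the two trapezoids. *)
Lemma tri_flux_mid' f w a b c : 0 < orient a b c -> a.1 <= c.1 -> c.1 <= b.1 ->
  (@mu2 R).-integrable setT (EFin \o f) ->
  vertical_flux f w (tri a b c) -> line_integrable w (tri a b c) ->
  \int[mu2]_(p in tri a b c) f p =
  - (edge_flux w a b + edge_flux w b c + edge_flux w c a).
Proof.
move=> o0 ac cb fi vf li; have ab := le_trans ac cb.
have ab' : a.1 < b.1.
  rewrite lt_neqAle ab andbT; apply/eqP => h; move: o0.
  have hc : c.1 = a.1 by apply/eqP; rewrite eq_le ac h cb.
  by rewrite /orient hc -h !subrr mul0r mulr0 subrr ltxx.
have oca p : a.1 < c.1 ->
    orient c a p = (c.1 - a.1) * (slope a c * p.1 + icpt a c - p.2).
  move=> ac'; have -> : orient c a p = - orient a c p by rewrite /orient; ring.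
  by rewrite orient_slope//; ring.
have obc p : c.1 < b.1 ->
    orient b c p = (b.1 - c.1) * (slope c b * p.1 + icpt c b - p.2).
  move=> cb'; have -> : orient b c p = - orient c b p by rewrite /orient; ring.
  by rewrite orient_slope//; ring.
have rhs : - (edge_flux w a b + edge_flux w b c + edge_flux w c a) =
    line_integral w a c + line_integral w c b - line_integral w a b.
  by rewrite (edge_fluxC w c a) (edge_fluxC w b c) !edge_flux_le//; ring.
pose L1 := trap a.1 c.1 (slope a b) (icpt a b) (slope a c) (icpt a c).
pose L2 := trap c.1 b.1 (slope a b) (icpt a b) (slope c b) (icpt c b).
have ab0 : 0 < b.1 - a.1 by rewrite subr_gt0.
have key1 (x y : R) : a.1 < x -> x < c.1 -> y <= slope a c * x + icpt a c ->
    0 <= orient b c (x, y).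
  move=> ax xc yl; have ac' := lt_trans ax xc.
  have e : (c.1 - a.1) * orient b c (x, y) = (c.1 - x) * orient a b c +
      (c.1 - a.1) * (b.1 - c.1) * ((slope a c * x + icpt a c) - y).
    by rewrite /orient /icpt /slope /=; field; rewrite subr_eq0 gt_eqF.
  rewrite -(pmulr_rge0 _ (_ : 0 < c.1 - a.1)) ?subr_gt0// e.
  by apply: addr_mulM_ge0; rewrite ?(ltW o0)// subr_ge0// ltW.
have key2 (x y : R) : c.1 < x -> x < b.1 -> y <= slope c b * x + icpt c b ->
    0 <= orient c a (x, y).
  move=> cx xb yl; have cb' := lt_trans cx xb.
  have e : (b.1 - c.1) * orient c a (x, y) = (x - c.1) * orient a b c +
      (b.1 - c.1) * (c.1 - a.1) * ((slope c b * x + icpt c b) - y).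
    by rewrite /orient /icpt /slope /=; field; rewrite subr_eq0 gt_eqF.
  rewrite -(pmulr_rge0 _ (_ : 0 < b.1 - c.1)) ?subr_gt0// e.
  by apply: addr_mulM_ge0; rewrite ?(ltW o0)// subr_ge0// ltW.
have s1 (x y : R) : a.1 < x -> x < c.1 -> slope a b * x + icpt a b <= y ->
    y <= slope a c * x + icpt a c -> tri a b c (x, y).
  move=> ax xc yl yh; have ac' := lt_trans ax xc; split.
  - by rewrite orient_slope// mulr_ge0// subr_ge0// ltW.
  - exact: key1.
  - by rewrite oca// mulr_ge0// subr_ge0// ltW.
have s2 (x y : R) : c.1 < x -> x < b.1 -> slope a b * x + icpt a b <= y ->
    y <= slope c b * x + icpt c b -> tri a b c (x, y).
  move=> cx xb yl yh; have cb' := lt_trans cx xb; split.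
  - by rewrite orient_slope// mulr_ge0// subr_ge0// ltW.
  - by rewrite obc// mulr_ge0// subr_ge0// ltW.
  - exact: key2.
have lh1 (x : R) : a.1 < x < c.1 -> slope a b * x + icpt a b < slope a c * x + icpt a c.
  move=> /andP[ax xc]; have ac' := lt_trans ax xc.
  have e : (slope a c * x + icpt a c - (slope a b * x + icpt a b)) *
     ((b.1 - a.1) * (c.1 - a.1)) = (x - a.1) * orient a b c.
    by rewrite /orient /icpt /slope /=; field; rewrite !subr_eq0 !gt_eqF.
  rewrite -subr_gt0; apply: pmulr_eq_gt0 e _ _; apply: mulr_gt0 => //;
    by rewrite subr_gt0.
have lh2 (x : R) : c.1 < x < b.1 -> slope a b * x + icpt a b < slope c b * x + icpt c b.
  move=> /andP[cx xb]; have cb' := lt_trans cx xb.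
  have e : (slope c b * x + icpt c b - (slope a b * x + icpt a b)) *
     ((b.1 - c.1) * (b.1 - a.1)) = (b.1 - x) * orient a b c.
    by rewrite /orient /icpt /slope /=; field; rewrite !subr_eq0 !gt_eqF.
  rewrite -subr_gt0; apply: pmulr_eq_gt0 e _ _; apply: mulr_gt0 => //;
    by rewrite subr_gt0.
have t1 : L1 `<=` tri a b c.
  by move=> [x y] [/= *]; apply: s1 => //; exact: ltW.
have t2 : L2 `<=` tri a b c.
  by move=> [x y] [/= *]; apply: s2 => //; exact: ltW.
have sT : tri a b c `\` tri_skeleton a b c `<=` L1 `|` L2.
  move=> p [Tp nN].
  have nz (P : Prop) : (P -> tri_skeleton a b c p) -> ~ P by move=> h /h.
  have n1 : orient a b p <> 0 by apply: nz => h; left; left; left.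
  have n2 : orient b c p <> 0 by apply: nz => h; left; left; right.
  have n3 : orient c a p <> 0 by apply: nz => h; left; right.
  have n4 : p.1 <> a.1 by apply: nz => h; right; left; left.
  have n5 : p.1 <> b.1 by apply: nz => h; right; left; right.
  have n6 : p.1 <> c.1 by apply: nz => h; right; right.
  have lt0 (t : R) : t <> 0 -> 0 <= t -> 0 < t.
    by move=> /eqP t0 t0'; rewrite lt_neqAle eq_sym t0.
  have [/(lt0 _ n1) p1 /(lt0 _ n2) p2 /(lt0 _ n3) p3] := Tp.
  have ax : a.1 < p.1.
    by rewrite lt_neqAle (tri_left o0 ab ac Tp) andbT eq_sym; exact/eqP.
  have xb : p.1 < b.1.
    have Tp' : tri c a b p by rewrite tri_cycle.
    have o0' : 0 < orient c a b by rewrite orient_cycle.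
    by rewrite lt_neqAle (tri_right o0' cb ab Tp') andbT; exact/eqP.
  have loP : slope a b * p.1 + icpt a b < p.2.
    by move: p1; rewrite orient_slope// pmulr_rgt0// subr_gt0.
  have [xc|cx|//] := ltgtP p.1 c.1.
    left; split => //; move: p3; rewrite oca; last exact: lt_trans ax xc.
    by rewrite pmulr_rgt0 ?subr_gt0// (lt_trans ax xc).
  right; split => //; move: p2; rewrite obc; last exact: lt_trans cx xb.
  by rewrite pmulr_rgt0 ?subr_gt0// (lt_trans cx xb).
have il1 : leb.-integrable `]a.1, c.1[ (EFin \o (fun x => w (x, slope a c * x + icpt a c))).
  by apply: li => x /[dup] /lh1 lh /andP[ax xb]; apply: s1 => //; exact: ltW.
have il2 : leb.-integrable `]c.1, b.1[ (EFin \o (fun x => w (x, slope c b * x + icpt c b))).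
  by apply: li => x /[dup] /lh2 lh /andP[ax xb]; apply: s2 => //; exact: ltW.
have iu : leb.-integrable `]a.1, b.1[ (EFin \o (fun x => w (x, slope a b * x + icpt a b))).
  apply: li => x /andP[ax xb]; split.
  - by rewrite orient_slope// subrr mulr0.
  - have e : (b.1 - a.1) * orient b c (x, slope a b * x + icpt a b) =
      (b.1 - x) * orient a b c.
      by rewrite /orient /icpt /slope /=; field; rewrite !subr_eq0 !gt_eqF.
    by rewrite -(pmulr_rge0 _ ab0) e mulr_ge0 ?(ltW o0)// subr_ge0 ltW.
  - have e : (b.1 - a.1) * orient c a (x, slope a b * x + icpt a b) =
      (x - a.1) * orient a b c.
      by rewrite /orient /icpt /slope /=; field; rewrite !subr_eq0 !gt_eqF.
    by rewrite -(pmulr_rge0 _ ab0) e mulr_ge0 ?(ltW o0)// subr_ge0 ltW.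
have iu1 : leb.-integrable `]a.1, c.1[ (EFin \o (fun x => w (x, slope a b * x + icpt a b))).
  by apply: integrableS iu => //; apply: subset_itvl; rewrite bnd_simp.
have iu2 : leb.-integrable `]c.1, b.1[ (EFin \o (fun x => w (x, slope a b * x + icpt a b))).
  by apply: integrableS iu => //; apply: subset_itvr; rewrite bnd_simp.
rewrite (tri_flux_split o0 fi t1 t2 sT) rhs !vf// !RintegralB// /line_integral.
rewrite (Rintegral_itv_split ac cb iu); ring.
Qed.

(* A version of Green's formula: f is the y-derivative of w. *)
Lemma tri_flux f w a b c : 0 < orient a b c ->
  (@mu2 R).-integrable setT (EFin \o f) ->
  vertical_flux f w (tri a b c) -> line_integrable w (tri a b c) ->
  \int[mu2]_(p in tri a b c) f p =
  - (edge_flux w a b + edge_flux w b c + edge_flux w c a).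
Proof.
move=> o0 fi vf li.
(* Both sides of the formula are invariant under cyclic relabelling, so the leftmost vertex may come
   first; only the order of the other two abscissas remains. *)
have leftmost A B C : 0 < orient A B C -> A.1 <= B.1 -> A.1 <= C.1 ->
    vertical_flux f w (tri A B C) -> line_integrable w (tri A B C) ->
    \int[mu2]_(p in tri A B C) f p =
    - (edge_flux w A B + edge_flux w B C + edge_flux w C A).
  move=> o1 AB AC vf1 li1; have [BC|/ltW CB] := leP B.1 C.1.
    exact: tri_flux_mid.
  exact: tri_flux_mid'.
have [ab|/ltW ba] := leP a.1 b.1.
  have [ac|/ltW ca] := leP a.1 c.1; first exact: leftmost.
  have := leftmost c a b; rewrite tri_cycle orient_cycle => ->//.
    by congr (- _); ring.
  exact: le_trans ca ab.
have [bc|/ltW cb] := leP b.1 c.1.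
  have := leftmost b c a; rewrite -tri_cycle -orient_cycle => ->//.
  by congr (- _); ring.
have := leftmost c a b; rewrite tri_cycle orient_cycle => ->//.
  by congr (- _); ring.
exact: le_trans cb ba.
Qed.

End triangles.

(** * Area of a triangle, exact edge integrals and gluing along a diagonal *)

Section triangle_area.
Context {R : realType}.
Notation leb := (@lebesgue_measure R).
Notation plane := (measurableTypeR R * measurableTypeR R)%type.
Implicit Types (a b c p P Q : R * R) (w f : R * R -> R).

Lemma tri_bounded a b c p : 0 < orient a b c -> tri a b c p ->
  `|p.1| <= `|a.1| + `|b.1| + `|c.1| /\ `|p.2| <= `|a.2| + `|b.2| + `|c.2|.
Proof.
move=> o0 [h1 h2 h3].
have aux (x y z t : R) : orient b c p * x + orient c a p * y + orient a b p * z =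
    orient a b c * t -> `|t| <= `|x| + `|y| + `|z|.
  move=> e; rewrite -(ler_pM2l o0) -{1}(gtr0_norm o0) -normrM -e.
  have le (s r : R) : 0 <= s -> s <= orient a b c -> `|s * r| <= orient a b c * `|r|.
    by move=> s0 so; rewrite normrM ger0_norm// ler_wpM2r.
  rewrite !mulrDr; apply: le_trans (ler_normD _ _) _; apply: lerD.
    apply: le_trans (ler_normD _ _) _; apply: lerD; apply: le => //.
      by rewrite -(orient_sum a b c p); lra.
    by rewrite -(orient_sum a b c p); lra.
  by apply: le => //; rewrite -(orient_sum a b c p); lra.
by split; apply: aux; [exact: orient_bary1|exact: orient_bary2].
Qed.

Lemma tri_box a b c : 0 < orient a b c ->
  tri a b c `<=` `[- (`|a.1| + `|b.1| + `|c.1|), `|a.1| + `|b.1| + `|c.1|]%classic `*`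
    `[- (`|a.2| + `|b.2| + `|c.2|), `|a.2| + `|b.2| + `|c.2|]%classic.
Proof.
move=> o0 p /(tri_bounded o0)[]; rewrite !ler_norml => h1 h2.
by split; rewrite /= in_itv.
Qed.

Lemma tri_compact a b c : 0 < orient a b c -> compact (tri a b c).
Proof.
move=> o0; apply: subclosed_compact (tri_box o0); first exact: tri_closed.
by apply: compact_setX; exact: segment_compact.
Qed.

Lemma tri_mu2_lty a b c : 0 < orient a b c -> ((@mu2 R) (tri a b c) < +oo)%E.
Proof.
move=> o0; apply: le_lt_trans (mu2_box_lty (- (`|a.1| + `|b.1| + `|c.1|))
  (`|a.1| + `|b.1| + `|c.1|) (- (`|a.2| + `|b.2| + `|c.2|)) (`|a.2| + `|b.2| + `|c.2|)).
apply: le_measure; rewrite ?inE; [exact: tri_measurable| |exact: tri_box].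
exact: measurableX.
Qed.

Lemma indic_integrable (D : set plane) : measurable D -> ((@mu2 R) D < +oo)%E ->
  (@mu2 R).-integrable setT (EFin \o \1_D).
Proof.
move=> mD lt; have i1 : (@mu2 R).-integrable D (EFin \o cst 1).
  apply: measurable_bounded_integrable => //.
  by exists 1; split => // C ltC p _ /=; rewrite normr1 ltW.
have := (iffLR (integrable_mkcond (EFin \o cst 1) mD)) i1.
apply: eq_integrable => // p _; rewrite patchE /= indicE.
by case: ifP.
Qed.

Lemma indic_tri_integrable a b c : 0 < orient a b c ->
  (@mu2 R).-integrable setT (EFin \o \1_(tri a b c)).
Proof.
by move=> o0; apply: indic_integrable; [exact: tri_measurable|exact: tri_mu2_lty].
Qed.

Lemma itv_affine_integrable (x0 x1 m q : R) :
  leb.-integrable `]x0, x1[ (EFin \o (fun x => m * x + q)).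
Proof.
have h : leb.-integrable `[x0, x1] (EFin \o (fun x => m * x + q)).
  apply: continuous_itv_integrable; apply: continuous_subspaceT => x.
  apply: cvgD; last exact: cvg_cst.
  by apply: cvgM; [exact: cvg_cst|exact: cvg_id].
by apply: integrableS h => //; exact: subset_itv_oo_cc.
Qed.

Lemma snd_line_integrable (T : set (R * R)) : line_integrable snd T.
Proof. by move=> x0 x1 m q _; exact: itv_affine_integrable. Qed.

Lemma leb_itvoo (x y : R) : x <= y -> fine (leb `]x, y[) = y - x.
Proof.
move=> xy; rewrite lebesgue_measure_itv/= lte_fin; case: ltP => //= yx.
by apply/eqP; rewrite eq_sym subr_eq0 eq_le xy yx.
Qed.

(** The indicator stands for the constant 1, which is not integrable over the whole plane as
    [tri_flux] demands. On each section of the trapezoid it integrates to the height. *)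
Lemma snd_vertical_flux a b c : 0 < orient a b c ->
  vertical_flux \1_(tri a b c) snd (tri a b c).
Proof.
move=> o0 x0 x1 m q m' q' lohi sT.
set D := trap _ _ _ _ _ _.
have mD : measurable (D : set plane) by exact: trap_measurable.
rewrite (_ : \int[mu2]_(p in D) _ = \int[mu2]_p \1_D p); last first.
  rewrite Rintegral_mkcond; congr Rintegral; apply/funext => p.
  rewrite patchE; case: ifPn => [/[dup] pD /set_mem Dp|nD].
    by rewrite !indicE pD mem_set//; exact: sT.
  by rewrite indicE (negbTE nD).
have iD : (@mu2 R).-integrable setT (EFin \o \1_D).
  apply: indic_integrable => //.
  apply: le_lt_trans (tri_mu2_lty o0); apply: le_measure; rewrite ?inE//.
  exact: tri_measurable.
have [_ ->] := Rfubini iD.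
rewrite (@Rintegral_restrict R _ _ leb setT `]x0, x1[%classic)//.
  apply: eq_Rintegral => x; rewrite inE/= in_itv/= => xx.
  transitivity (\int[leb]_(y in `]m * x + q, m' * x + q'[) 1).
    rewrite [RHS]Rintegral_mkcond; congr Rintegral; apply/funext => y.
    rewrite patchE indicE; have /andP[xx0 xx1] := xx.
    have -> : ((x, y) \in D) = (y \in `]m * x + q, m' * x + q'[%classic).
      apply/idP/idP; rewrite !inE /= in_itv/=; first by case=> _ _ /= -> ->.
      by move=> /andP[? ?]; split.
    by case: ifP.
  by rewrite Rintegral_cst// mul1r leb_itvoo// ltW// lohi.
move=> x _; rewrite /= in_itv/= => xx.
rewrite (_ : (fun y => _) = cst 0) ?Rintegral_cst ?mul0r//.
apply/funext => y; rewrite indicE memNset// => -[/= h1 h2 _ _].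
by apply: xx; rewrite h1 h2.
Qed.

Lemma Rintegral_affine (x0 x1 m q : R) : x0 <= x1 ->
  \int[leb]_(x in `]x0, x1[) (m * x + q) =
  (x1 - x0) * (m * x0 + q + (m * x1 + q)) / 2.
Proof.
rewrite le_eqVlt => /orP[/eqP <-|x01].
  by rewrite set_itv_ge ?Rintegral_set0 ?bnd_simp ?ltxx// subrr mul0r mul0r.
have i := itv_affine_integrable x0 x1 m q.
pose F x : R := m / 2 * (x * x) + q * x.
have dF (x : R) : is_derive x 1 F (m * x + q).
  have di : is_derive x 1 (@id R) 1 by exact: is_derive_id.
  have dF := is_deriveD (is_deriveZ (m / 2) (is_deriveM di di)) (is_deriveZ q di).
  apply: (is_derive_congr dF); first by move=> y.
  by rewrite /GRing.scale /=; field.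
have cF : continuous F.
  move=> x; apply: differentiable_continuous; apply/derivable1_diffP.
  by have [] := dF x.
rewrite (Rintegral_itv_bndo_bndc i) (@Rintegral_itv_obnd_cbnd R x0 (BRight x1)); last first.
  by apply: integrableS (itv_affine_integrable (x0 - 1) (x1 + 1) m q) => //;
    apply: subset_itv; rewrite bnd_simp; lra.
rewrite /Rintegral (@continuous_FTC2 _ _ F)//.
- by rewrite /F /=; field.
- apply: continuous_subspaceT => x; apply: cvgD; last exact: cvg_cst.
  by apply: cvgM; [exact: cvg_cst|exact: cvg_id].
- split; first by move=> y _; have [] := dF y.
    by apply: cvg_at_right_filter; exact: cF.
  by apply: cvg_at_left_filter; exact: cF.
- by move=> y _; rewrite derive1E; have [] := dF y.
Qed.

Lemma line_integral_affine w P Q : P.1 <= Q.1 ->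
  (forall t, 0 <= t <= 1 -> w (seg P Q t) = (1 - t) * w P + t * w Q) ->
  line_integral w P Q = (Q.1 - P.1) * (w P + w Q) / 2.
Proof.
rewrite le_eqVlt => /orP[/eqP PQ _|PQ wa].
  by rewrite line_integral0 ?PQ// subrr !mul0r.
have PQ0 : Q.1 - P.1 != 0 by rewrite subr_eq0 gt_eqF.
pose m := (w Q - w P) / (Q.1 - P.1); pose q := w P - m * P.1.
transitivity (\int[leb]_(x in `]P.1, Q.1[) (m * x + q)); last first.
  by rewrite Rintegral_affine ?ltW// /q /m; field.
apply: eq_Rintegral => x; rewrite inE/= in_itv/= => /andP[Px xQ].
pose t := (x - P.1) / (Q.1 - P.1).
have -> : (x, slope P Q * x + icpt P Q) = seg P Q t.
  rewrite /seg [RHS]surjective_pairing /= /GRing.scale /=.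
  by congr (_, _); rewrite /icpt /slope /t; field.
rewrite wa; first by rewrite /q /m /t; field.
apply/andP; split; first by rewrite divr_ge0// subr_ge0 ltW// (lt_trans Px).
by rewrite ler_pdivrMr ?subr_gt0// mul1r; lra.
Qed.

Lemma edge_flux_affine w P Q :
  (forall t, 0 <= t <= 1 -> w (seg P Q t) = (1 - t) * w P + t * w Q) ->
  edge_flux w P Q = (Q.1 - P.1) * (w P + w Q) / 2.
Proof.
move=> wa; have [PQ|/ltW QP] := leP P.1 Q.1.
  by rewrite edge_flux_le// line_integral_affine.
rewrite edge_fluxC edge_flux_le// line_integral_affine//; first by field.
move=> t /andP[t0 t1]; have -> : seg Q P t = seg P Q (1 - t).
  by rewrite /seg opprB addrCA subrr addr0 addrC.
rewrite wa; first by ring.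
by apply/andP; split; lra.
Qed.

Lemma tri_area a b c : 0 < orient a b c ->
  fine ((@mu2 R) (tri a b c)) = orient a b c / 2.
Proof.
move=> o0; have mT := @tri_measurable R a b c.
transitivity (\int[mu2]_(p in tri a b c) \1_(tri a b c) p).
  rewrite -[LHS]mul1r -(Rintegral_cst (@mu2 R) mT).
  by apply: eq_Rintegral => p; rewrite indicE => ->.
rewrite (tri_flux o0 (indic_tri_integrable o0) (snd_vertical_flux o0)
  (@snd_line_integrable _)).
rewrite !edge_flux_affine; first by rewrite /orient; field.
all: by move=> t _; rewrite /seg /= /GRing.scale.
Qed.

Section union.
Variables (a b c d : R * R).
Hypotheses (abc : 0 < orient a b c) (acd : 0 < orient a c d).
Let N : set (R * R) := [set p | orient a c p = 0].

Lemma tri2_split :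
  [/\ (tri a b c `|` tri a c d) `\` N = (tri a b c `\` N) `|` (tri a c d `\` N) &
      [disjoint tri a b c `\` N & tri a c d `\` N]].
Proof.
split; first by rewrite setDUl.
apply/disj_setPS => p [[[_ _ h3] nN] [[h1 _ _] _]]; apply: nN.
rewrite /N /=; have ca : orient c a p = - orient a c p by rewrite /orient; ring.
by apply/eqP; rewrite eq_le h1 -oppr_ge0 -ca h3.
Qed.

Lemma diagonal_null : measurable (N : set plane) /\ (@mu2 R) N = 0%E.
Proof.
apply: edge_line_null; apply/eqP => h; move: abc; rewrite h /orient; lra.
Qed.

Lemma Rintegral_tri2 f : (@mu2 R).-integrable setT (EFin \o f) ->
  \int[mu2]_(p in tri a b c `|` tri a c d) f p =
  \int[mu2]_(p in tri a b c) f p + \int[mu2]_(p in tri a c d) f p.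
Proof.
move=> fi; have [sU dU] := tri2_split; have [mN N0] := diagonal_null.
have m1 := @tri_measurable R a b c; have m2 := @tri_measurable R a c d.
have mU : measurable (tri a b c `|` tri a c d : set plane) by exact: measurableU.
have fiD (D : set plane) : measurable D -> (@mu2 R).-integrable D (EFin \o f).
  by move=> mD'; apply: integrableS fi.
rewrite (Rintegral_null_diff mU mN (fiD _ mU) N0) sU.
rewrite (Rintegral_null_diff m1 mN (fiD _ m1) N0).
rewrite (Rintegral_null_diff m2 mN (fiD _ m2) N0).
rewrite Rintegral_setU//; try exact: measurableD.
by apply: fiD; apply: measurableU; exact: measurableD.
Qed.

Lemma tri2_area :
  fine ((@mu2 R) (tri a b c `|` tri a c d)) = (orient a b c + orient a c d) / 2.
Proof.
have mU : measurable (tri a b c `|` tri a c d : set plane).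
  by apply: measurableU; exact: tri_measurable.
have lt : ((@mu2 R) (tri a b c `|` tri a c d) < +oo)%E.
  apply: (@le_lt_trans _ _ ((@mu2 R) (tri a b c) + (@mu2 R) (tri a c d))%E).
    by apply: measureU2; exact: tri_measurable.
  by rewrite lte_add_pinfty// tri_mu2_lty.
have fi : (@mu2 R).-integrable setT (EFin \o \1_(tri a b c `|` tri a c d)).
  exact: indic_integrable.
have h (T : set plane) : measurable T -> T `<=` tri a b c `|` tri a c d ->
    fine ((@mu2 R) T) = \int[mu2]_(p in T) \1_(tri a b c `|` tri a c d) p.
  move=> mT sT; rewrite -[LHS]mul1r -(Rintegral_cst (@mu2 R) mT).
  by apply: eq_Rintegral => p /set_mem Tp; rewrite indicE mem_set//; exact: sT.
rewrite h// Rintegral_tri2// -!h//; try exact: tri_measurable.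
by rewrite !tri_area//; field.
Qed.

Lemma tri2_flux f w : (@mu2 R).-integrable setT (EFin \o f) ->
  vertical_flux f w (tri a b c) -> line_integrable w (tri a b c) ->
  vertical_flux f w (tri a c d) -> line_integrable w (tri a c d) ->
  \int[mu2]_(p in tri a b c `|` tri a c d) f p =
  - (edge_flux w a b + edge_flux w b c + edge_flux w c d + edge_flux w d a).
Proof.
move=> fi v1 l1 v2 l2; rewrite Rintegral_tri2// (@tri_flux R f w a b c)// (@tri_flux R f w a c d)//.
rewrite (edge_fluxC w c a); ring.
Qed.

End union.

End triangle_area.

(** * Flux of a weak derivative through two adjacent triangles *)

Section weak_flux.
Context {R : realType}.
Notation leb := (@lebesgue_measure R).
Notation plane := (measurableTypeR R * measurableTypeR R)%type.
Implicit Types (a b c p P Q : R * R) (u w f g : R * R -> R).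

Lemma cvg_within_comp (S T : topologicalType) (f : S -> T) (A : set S) (B : set T) x :
  (forall y, A y -> B (f y)) -> {for x, continuous f} ->
  f @ within A (nbhs x) --> within B (nbhs (f x)).
Proof.
move=> AB cf P nP; have h := cf _ nP.
change (nbhs x (fun t => A t -> P (f t))).
by apply: (@filterS _ (nbhs x) _ _ _ _ h) => z /= BP /AB; exact: BP.
Qed.

(** Both ends are limits of interior points. It serves to place the upper and lower sides of an open
    trapezoid inside a closed set that contains the trapezoid. *)
Lemma closed_itv_ends (A : set R) (l h : R) : l < h -> closed A ->
  `]l, h[ `<=` A -> `[l, h] `<=` A.
Proof.
move=> lh cA sA y; rewrite /= in_itv/= => /andP[].
rewrite le_eqVlt => /orP[/eqP <- _|ly].
  apply: cA => B Bl; have Br : \forall t \near l^'+, B t by apply: cvg_within.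
  have AB : \forall t \near l^'+, (A `&` B) t.
    near=> t; split; last by near: t.
    by apply: sA; rewrite /= in_itv/=; apply/andP; split; near: t;
      [exact: nbhs_right_gt|exact: nbhs_right_lt].
  by have [t ABt] := @filter_ex _ _ (at_right_proper_filter l) _ AB; exists t.
rewrite le_eqVlt => /orP[/eqP ->|yh]; last by apply: sA; rewrite /= in_itv/= ly yh.
apply: cA => B Bl; have Br : \forall t \near h^'-, B t by apply: cvg_within.
have AB : \forall t \near h^'-, (A `&` B) t.
  near=> t; split; last by near: t.
  by apply: sA; rewrite /= in_itv/=; apply/andP; split; near: t;
    [exact: nbhs_left_gt|exact: nbhs_left_lt].
by have [t ABt] := @filter_ex _ _ (at_left_proper_filter h) _ AB; exists t.
Unshelve. all: by end_near. Qed.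

Lemma pair_continuous (x : R) : continuous (fun y : R => (x, y) : R * R).
Proof.
by move=> y; apply: (@cvg_pair _ _ _ _ (nbhs x) (nbhs y)); [exact: cvg_cst|exact: cvg_id].
Qed.

Lemma slice_continuous (T : set (R * R)) u (x l h : R) :
  (forall y, l <= y <= h -> T (x, y)) -> {within T, continuous u} ->
  {within `[l, h], continuous (fun y => u (x, y))}.
Proof.
move=> sT /subspace_continuousP cu; apply/subspace_continuousP => y.
rewrite /= in_itv/= => ylh.
have h1 : (fun y => (x, y)) @ within `[l, h]%classic (nbhs y) --> within T (nbhs (x, y)).
  apply: cvg_within_comp; last exact: pair_continuous.
  by move=> z; rewrite /= in_itv/=; exact: sT.
exact: cvg_comp h1 (cu _ (sT _ ylh)).
Qed.

(** An open trapezoid inside T lies in the interior of T, so its cutoffs are admissible in the weak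
    identity; its upper and lower sides lie in T by closedness, and u is continuous and bounded
    there. *)
Lemma weak_vertical_flux (T : set (R * R)) u g (K : R) : closed T ->
  (@mu2 R).-integrable setT (EFin \o u) ->
  (@mu2 R).-integrable setT (EFin \o g) ->
  {within T, continuous u} -> (forall p, T p -> `|u p| <= K) ->
  (forall psi, smooth psi -> test_function T° psi ->
    \int[mu2]_p (u p * partial 1 psi p) = - \int[mu2]_p (g p * psi p)) ->
  vertical_flux g u T.
Proof.
move=> cT iu ig cu uK weak x0 x1 m q m' q' lohi sT.
have slice (x y : R) : x0 < x < x1 -> m * x + q <= y <= m' * x + q' -> T (x, y).
  move=> xx yy; pose A := [set z | T (x, z)].
  have cA : closed A.
    apply: (@closed_comp _ _ (fun z : R => (x, z) : R * R)) => // z _.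
    exact: pair_continuous.
  have sA : `]m * x + q, m' * x + q'[ `<=` A.
    move=> z; rewrite /= in_itv/= => /andP[? ?]; have /andP[? ?] := xx.
    by apply: sT; split.
  by apply: (closed_itv_ends (lohi _ xx) cA sA); rewrite /= in_itv.
apply: (@trapezoid_flux R x0 x1 m q m' q' K) => //.
- by move=> x xx; apply: slice_continuous cu => y yy; exact: slice.
- by move=> x y xx yy; apply: uK; exact: slice.
- move=> psi spsi [p1 p2 p3]; apply: weak => //; split => //.
  apply: subset_trans p3 _.
  by rewrite -open_subsetE//; exact: trap_open.
Qed.

Lemma bounded_line_integrable (T : set (R * R)) u (K : R) :
  (@mu2 R).-integrable setT (EFin \o u) -> (forall p, T p -> `|u p| <= K) ->
  line_integrable u T.
Proof.
move=> iu uK x0 x1 m q sT.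
have mu : measurable_fun [set: plane] u by apply/measurable_EFinP; exact: measurable_int iu.
have h : (leb (`]x0, x1[%classic : set R) < +oo)%E.
  by rewrite lebesgue_measure_itv/=; case: ifP => _; rewrite -?EFinB ltry.
apply: measurable_bounded_integrable => //.
  apply: measurable_funTS; apply: (@measurableT_comp _ _ _ _ _ _ u) => //.
  apply: measurable_fun_pair => //; apply: measurable_funD; last exact: measurable_cst.
  by apply: measurable_funM => //; exact: measurable_cst.
exists K; split; first exact: num_real.
move=> C KC x; rewrite /= in_itv/= => xx; apply: le_trans (ltW KC).
by apply: uK; exact: sT.
Qed.

Lemma within_compact_bounded (T : set (R * R)) u : compact T ->
  {within T, continuous u} -> exists K, forall p, T p -> `|u p| <= K.
Proof.
move=> cT cu; have /compact_bounded[M [Mr MT]] := continuous_compact cu cT.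
exists (M + 1) => p Tp; apply: (MT (M + 1)); first by rewrite ltrDl.
by exists p.
Qed.

Definition affine_on u P Q :=
  forall t, 0 <= t <= 1 -> u (seg P Q t) = (1 - t) * u P + t * u Q.

Lemma affine_onC u P Q : affine_on u P Q -> affine_on u Q P.
Proof.
move=> uPQ t /andP[t0 t1]; have -> : seg Q P t = seg P Q (1 - t).
  by rewrite /seg opprB addrCA subrr addr0 addrC.
rewrite uPQ; first by ring.
by apply/andP; split; lra.
Qed.

(** The right-hand side is minus the boundary integral of u dx, by the trapezoidal rule, which is
    exact for a function affine on each edge. *)
Lemma weak_flux1 a b c d u g :
  0 < orient a b c -> 0 < orient a c d ->
  (@mu2 R).-integrable setT (EFin \o u) ->
  (@mu2 R).-integrable setT (EFin \o g) ->
  {within tri a b c `|` tri a c d, continuous u} ->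
  (forall psi, smooth psi -> test_function (tri a b c `|` tri a c d)° psi ->
    \int[mu2]_p (u p * partial 1 psi p) = - \int[mu2]_p (g p * psi p)) ->
  affine_on u a b -> affine_on u b c -> affine_on u c d -> affine_on u d a ->
  \int[mu2]_(p in tri a b c `|` tri a c d) g p =
  - ((b.1 - a.1) * (u a + u b) + (c.1 - b.1) * (u b + u c) +
     (d.1 - c.1) * (u c + u d) + (a.1 - d.1) * (u d + u a)) / 2.
Proof.
move=> abc acd iu ig cu weak uab ubc ucd uda.
set U := _ `|` _ in cu weak *.
have s1 : tri a b c `<=` U by move=> p; left.
have s2 : tri a c d `<=` U by move=> p; right.
have cU : compact U by apply: compactU; exact: tri_compact.
have [K uK] := within_compact_bounded cU cu.
have vf T : closed T -> T `<=` U -> vertical_flux g u T.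
  move=> cT sT; apply: (@weak_vertical_flux T u g K) => //.
  - exact: continuous_subspaceW cu.
  - by move=> p Tp; apply: uK; exact: sT.
  - move=> psi spsi [p1 p2 p3]; apply: weak => //; split => //.
    by apply: subset_trans p3 _; exact: interiorS.
have li T : T `<=` U -> line_integrable u T.
  by move=> sT; apply: (@bounded_line_integrable T u K) => // p Tp; apply: uK; exact: sT.
rewrite (tri2_flux abc acd (w := u))//.
- by rewrite !edge_flux_affine//; field.
- by apply: vf => //; exact: tri_closed.
- exact: li.
- by apply: vf => //; exact: tri_closed.
- exact: li.
Qed.

(** Carries y-derivatives to x-derivatives. It preserves the measure but reverses orientation, so
    vertices are listed backwards after it. *)
Definition flip p : R * R := (p.2, p.1).

Lemma flipK : involutive flip. Proof. by case. Qed.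

Lemma flip_measurable : measurable_fun [set: plane] (flip : plane -> plane).
Proof. by apply: measurable_fun_pair; [exact: measurable_snd|exact: measurable_fst]. Qed.

Lemma flip_continuous : continuous flip.
Proof.
move=> p; apply: (@cvg_pair _ _ _ _ (nbhs p.2) (nbhs p.1)); [exact: cvg_snd|exact: cvg_fst].
Qed.

Lemma ge0_integral_flip (f : plane -> \bar R) : measurable_fun setT f ->
  (forall p, 0 <= f p)%E ->
  (\int[@mu2 R]_p f (flip p) = \int[@mu2 R]_p f p)%E.
Proof.
move=> mf f0; rewrite /mu2 !fubini_tonelli1//; last first.
  exact: measurableT_comp mf flip_measurable.
exact/esym/(@fubini_tonelli _ _ _ _ _ leb leb f).
Qed.

(** Tonelli is applied to the positive and negative parts separately, so that measurability
    suffices. *)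
Lemma Rintegral_flip (f : plane -> R) : measurable_fun setT f ->
  \int[@mu2 R]_p f (flip p) = \int[@mu2 R]_p f p.
Proof.
move=> mf; rewrite /Rintegral; congr fine.
have mE : measurable_fun setT (EFin \o f) by exact/measurable_EFinP.
rewrite integralE [RHS]integralE.
have p0 := ge0_integral_flip (measurable_funepos mE) (fun p => funepos_ge0 _ p).
have n0 := ge0_integral_flip (measurable_funeneg mE) (fun p => funeneg_ge0 _ p).
have e1 : (fun p => (f (flip p))%:E)^\+%E = (fun p => (EFin \o f)^\+%E (flip p)).
  by apply/funext => p; rewrite !funeposE.
have e2 : (fun p => (f (flip p))%:E)^\-%E = (fun p => (EFin \o f)^\-%E (flip p)).
  by apply/funext => p; rewrite !funenegE.
by rewrite e1 e2 p0 n0.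
Qed.

Lemma integrable_flip (f : plane -> R) : (@mu2 R).-integrable setT (EFin \o f) ->
  (@mu2 R).-integrable setT (EFin \o (f \o flip)).
Proof.
move=> /integrableP[mf lt]; apply/integrableP; split.
  exact: measurableT_comp mf flip_measurable.
rewrite (ge0_integral_flip (f := fun p => `|(f p)%:E|)%E)//.
exact: measurableT_comp.
Qed.

(** The reason why the weak identities are quantified over [smooth] test functions: the class is
    stable under the exchange, and its members and their partial derivatives are measurable, as
    [Rintegral_flip] requires. *)
Lemma smooth_flip f : smooth f -> smooth (f \o flip).
Proof.
elim=> {f} [n a b c|c|f g _ sf _ sg|f g _ sf _ sg|f f0 _ sf].
- have -> : (fun p => flat n (a * p.1 + b * p.2 + c)) \o flip =
            (fun p => flat n (b * p.1 + a * p.2 + c)).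
    by apply/funext => p /=; congr flat; ring.
  exact: smooth_flat.
- exact: smooth_cst.
- exact: smoothD.
- exact: smoothM.
- by apply: smoothV.
Qed.

Lemma partial_flip f p : partial 0 (f \o flip) p = partial 1 f (flip p).
Proof.
have -> : flip p = (p.2, p.1) by [].
have e0 : @basis2 R 0 = (1, 0) by [].
have e1 : @basis2 R 1 = (0, 1) by [].
by rewrite /partial /derive e0 e1.
Qed.

Lemma test_function_flip (U : set (R * R)) psi : smooth psi ->
  test_function U psi -> test_function (flip @^-1` U) (psi \o flip).
Proof.
move=> spsi [p1 p2 p3].
have s : closure [set x | (psi \o flip) x != 0] `<=`
    flip @^-1` closure [set x | psi x != 0].
  rewrite closureE => p; apply; split.
    apply: (@closed_comp _ _ flip); last exact: closed_closure.
    by move=> x _; exact: flip_continuous.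
  by move=> r /= h; apply: subset_closure.
split.
- by move=> n; exact/smooth_Ck/smooth_flip.
- apply: (subclosed_compact _ _ s); first exact: closed_closure.
  have -> : flip @^-1` closure [set x | psi x != 0] =
            flip @` closure [set x | psi x != 0].
    apply/seteqP; split => x /= h; first by exists (flip x); rewrite ?flipK.
    by case: h => y hy <-; rewrite flipK.
  apply: continuous_compact => //; apply: continuous_subspaceT.
  exact: flip_continuous.
- by move=> x /s; exact: p3.
Qed.

Lemma orient_flip a b c : orient (flip a) (flip b) (flip c) = orient a c b.
Proof. rewrite /orient /=; ring. Qed.

Lemma tri_flip a b c : tri (flip a) (flip c) (flip b) = flip @^-1` tri a b c.
Proof.
have h x y p : orient (flip x) (flip y) p = orient y x (flip p).
  by rewrite /orient /=; ring.
by apply/seteqP; split => p [h1 h2 h3]; split; rewrite /= ?h// -h.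
Qed.

Lemma interior_flip (U : set (R * R)) : flip @^-1` (flip @^-1` U)° `<=` U°.
Proof.
rewrite -open_subsetE; last first.
  apply: (@open_comp _ _ flip); last exact: open_interior.
  by move=> x _; exact: flip_continuous.
by move=> p /= /interior_subset; rewrite /= flipK.
Qed.

Lemma affine_on_flip u P Q : affine_on u P Q -> affine_on (u \o flip) (flip P) (flip Q).
Proof. by move=> h t t01; rewrite /= !flipK -h. Qed.

(** This is [weak_flux1] on the mirrored region with the vertices in the order a, d, c, b, again
    positively oriented. Traversing the edges backwards turns the minus sign into a plus. *)
Lemma weak_flux0 a b c d u g :
  0 < orient a b c -> 0 < orient a c d ->
  (@mu2 R).-integrable setT (EFin \o u) ->
  (@mu2 R).-integrable setT (EFin \o g) ->
  {within tri a b c `|` tri a c d, continuous u} ->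
  (forall psi, smooth psi -> test_function (tri a b c `|` tri a c d)° psi ->
    \int[mu2]_p (u p * partial 0 psi p) = - \int[mu2]_p (g p * psi p)) ->
  affine_on u a b -> affine_on u b c -> affine_on u c d -> affine_on u d a ->
  \int[mu2]_(p in tri a b c `|` tri a c d) g p =
  ((b.2 - a.2) * (u a + u b) + (c.2 - b.2) * (u b + u c) +
   (d.2 - c.2) * (u c + u d) + (a.2 - d.2) * (u d + u a)) / 2.
Proof.
move=> abc acd iu ig cu weak uab ubc ucd uda.
set U := _ `|` _ in cu weak *.
have mU : measurable (U : set plane) by apply: measurableU; exact: tri_measurable.
have mu : measurable_fun [set: plane] u by apply/measurable_EFinP; exact: measurable_int iu.
have mg : measurable_fun [set: plane] g by apply/measurable_EFinP; exact: measurable_int ig.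
have UE : tri (flip a) (flip d) (flip c) `|` tri (flip a) (flip c) (flip b) = flip @^-1` U.
  by rewrite !tri_flip setUC /U preimage_setU.
have mpart psi k : smooth psi -> measurable_fun [set: plane] (partial k psi).
  move=> spsi; have [dg sdg ddg] := smooth_derive (basis2 k) spsi.
  suff -> : partial k psi = dg by exact: smooth_measurable.
  by apply/funext => p; rewrite /partial; have [] := ddg p.
have := @weak_flux1 (flip a) (flip d) (flip c) (flip b) (u \o flip) (g \o flip).
rewrite !orient_flip UE => /(_ acd abc (integrable_flip iu) (integrable_flip ig)).
have cu' : {within flip @^-1` U, continuous (u \o flip)}.
  apply/subspace_continuousP => p Up.
  have h1 : flip @ within (flip @^-1` U) (nbhs p) --> within U (nbhs (flip p)).
    by apply: cvg_within_comp => //; exact: flip_continuous.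
  have /subspace_continuousP cu1 := cu.
  exact: cvg_comp h1 (cu1 _ Up).
move=> /(_ cu'); have weak' psi : smooth psi -> test_function (flip @^-1` U)° psi ->
    \int[mu2]_p ((u \o flip) p * partial 1 psi p) = - \int[mu2]_p ((g \o flip) p * psi p).
  move=> spsi tpsi; have spsi' := smooth_flip spsi.
  have tpsi' : test_function U° (psi \o flip).
    have [t1 t2 t3] := test_function_flip spsi tpsi.
    by split => //; apply: subset_trans t3 _; exact: interior_flip.
  have := weak _ spsi' tpsi'.
  rewrite -(Rintegral_flip (f := fun p => u p * partial 0 (psi \o flip) p)); last first.
    by apply: measurable_funM => //; exact: mpart.
  rewrite -(Rintegral_flip (f := fun p => g p * (psi \o flip) p)); last first.
    by apply: measurable_funM => //; exact: smooth_measurable.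
  have e1 : (fun p => u (flip p) * partial 0 (psi \o flip) (flip p)) =
            (fun p => (u \o flip) p * partial 1 psi p).
    by apply/funext => p; rewrite partial_flip flipK.
  have e2 : (fun p => g (flip p) * (psi \o flip) (flip p)) =
            (fun p => (g \o flip) p * psi p).
    by apply/funext => p; rewrite /= flipK.
  by rewrite e1 e2.
move=> /(_ weak') /(_ (affine_on_flip (affine_onC uda)) (affine_on_flip (affine_onC ucd))).
move=> /(_ (affine_on_flip (affine_onC ubc)) (affine_on_flip (affine_onC uab))).
rewrite Rintegral_mkcond.
have -> : (g \o flip) \_ (flip @^-1` U) = (g \_ U) \o flip.
  by apply/funext => p; rewrite /= !patchE; congr (if _ then _ else _);
    apply/idP/idP; rewrite !inE.
rewrite [X in X = _ -> _](Rintegral_flip (f := g \_ U)); last first.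
  exact/(measurable_restrictT g mU)/measurable_funTS.
by rewrite -Rintegral_mkcond => ->; rewrite /= !flipK; field.
Qed.

End weak_flux.

(** * The region bounded by a quadrilateral *)

Section quad_region.
Context {R : realType}.
Implicit Types (a b c d p x P Q : R * R).

Definition segment P Q : set (R * R) := seg P Q @` `[0, 1]%classic.

Lemma orient_seg P Q X Y (t : R) :
  orient P Q (seg X Y t) = (1 - t) * orient P Q X + t * orient P Q Y.
Proof. rewrite /orient /seg /= /GRing.scale /=; ring. Qed.

Lemma orient_ll P Q : orient P Q P = 0. Proof. rewrite /orient; ring. Qed.
Lemma orient_lr P Q : orient P Q Q = 0. Proof. rewrite /orient; ring. Qed.

Lemma segment_orient0 P Q p : segment P Q p -> orient P Q p = 0.
Proof. by move=> [t _ <-]; rewrite orient_seg orient_ll orient_lr !mulr0 addr0. Qed.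

Lemma orient_gt0_open P Q : open [set p | 0 < orient P Q p].
Proof. under eq_set do rewrite orient_affine; exact: halfplane_open. Qed.

Lemma orientN P Q p : orient Q P p = - orient P Q p.
Proof. rewrite /orient; ring. Qed.

Lemma tri_edge a b c p : 0 < orient a b c -> tri a b c p -> orient a b p = 0 ->
  segment a b p.
Proof.
move=> o0 [h1 h2 h3] h; have s := orient_sum a b c p.
(* The barycentric coordinate of p relative to b. *)
exists (orient c a p / orient a b c).
  rewrite /= in_itv/= divr_ge0 ?(ltW o0)//= ler_pdivrMr// mul1r; lra.
have e1 := orient_bary1 a b c p; have e2 := orient_bary2 a b c p.
have n0 : orient a b c != 0 by rewrite gt_eqF.
have hb : orient b c p = orient a b c - orient c a p by lra.
rewrite h mul0r addr0 hb in e1; rewrite h mul0r addr0 hb in e2.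
rewrite /seg [RHS]surjective_pairing [LHS]surjective_pairing /= /GRing.scale /=.
by congr (_, _); apply: (mulfI n0); rewrite -?e1 -?e2; field.
Qed.

Lemma tri_seg a b c X Y (t : R) : tri a b c X -> tri a b c Y -> 0 <= t <= 1 ->
  tri a b c (seg X Y t).
Proof.
move=> [x1 x2 x3] [y1 y2 y3] /andP[t0 t1]; have t1' : 0 <= 1 - t by rewrite subr_ge0.
by split; rewrite orient_seg addr_ge0// mulr_ge0.
Qed.

Lemma tri_vertex a b c : 0 < orient a b c ->
  [/\ tri a b c a, tri a b c b & tri a b c c].
Proof.
move=> o0; have ob : 0 <= orient b c a by rewrite -orient_cycle ltW.
have oc : 0 <= orient c a b by rewrite orient_cycle ltW.
by split; split; rewrite ?orient_ll ?orient_lr// ltW.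
Qed.

Section two_triangles.
Variables (a b c d : R * R).
Hypotheses (abc : 0 < orient a b c) (acd : 0 < orient a c d).
Let T1 := tri a b c.
Let T2 := tri a c d.
Let U := T1 `|` T2.
Definition contour := segment a b `|` segment b c `|` segment c d `|` segment d a.
Let B := contour.

Lemma contour_sub : B `<=` U.
Proof.
have [a1 b1 c1] := tri_vertex abc; have [a2 c2 d2] := tri_vertex acd.
by move=> p [[[|]|]|] [t]; rewrite /= in_itv/= => t01 <-;
  [left|left|right|right]; exact: tri_seg.
Qed.

Lemma region_closed : closed U.
Proof. by apply: closedU; exact: tri_closed. Qed.

Lemma region_compact : compact U.
Proof. by apply: compactU; exact: tri_compact. Qed.

(** The two open triangles miss the open diagonal. The third set contains it, and stays in the
    region because each of its points lies in one triangle or the other according to its side of the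
    diagonal. In the nonconvex case the third set alone is too small, hence the union. *)
Definition inside : set (R * R) :=
  [set p | [/\ 0 < orient a b p, 0 < orient b c p & 0 < orient c a p]] `|`
  [set p | [/\ 0 < orient a c p, 0 < orient c d p & 0 < orient d a p]] `|`
  [set p | [/\ 0 < orient a b p, 0 < orient b c p, 0 < orient c d p & 0 < orient d a p]].

Lemma inside_open : open inside.
Proof.
apply: openU; first apply: openU.
- rewrite (_ : mkset _ = [set p | 0 < orient a b p] `&` [set p | 0 < orient b c p] `&`
    [set p | 0 < orient c a p]); last by apply/seteqP; split => p /= => [[]|[[]]].
  by do ! apply: openI; exact: orient_gt0_open.
- rewrite (_ : mkset _ = [set p | 0 < orient a c p] `&` [set p | 0 < orient c d p] `&`
    [set p | 0 < orient d a p]); last by apply/seteqP; split => p /= => [[]|[[]]].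
  by do ! apply: openI; exact: orient_gt0_open.
- rewrite (_ : mkset _ = [set p | 0 < orient a b p] `&` [set p | 0 < orient b c p] `&`
    [set p | 0 < orient c d p] `&` [set p | 0 < orient d a p]); last first.
    by apply/seteqP; split => p /= => [[]|[[[]]]].
  by do ! apply: openI; exact: orient_gt0_open.
Qed.

(** The contour avoids the open triangle a b c: two of its edges lie on sides of that triangle, the
    other two beyond the diagonal a c. *)
Lemma contour_in1 p : B p -> [\/ orient a b p = 0, orient b c p = 0 | orient c a p <= 0].
Proof.
move=> [[[/segment_orient0 h|/segment_orient0 h]|[t]]|[t]].
- by constructor 1.
- by constructor 2.
- rewrite /= in_itv/= => /andP[t0 t1] <-; constructor 3.
  rewrite orient_seg orient_ll mulr0 add0r orientN.
  by rewrite mulrN oppr_le0 mulr_ge0// ltW.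
- rewrite /= in_itv/= => /andP[t0 t1] <-; constructor 3.
  rewrite orient_seg orient_lr mulr0 addr0 orientN.
  by rewrite mulrN oppr_le0 mulr_ge0 ?(ltW acd)// subr_ge0.
Qed.

Lemma contour_in2 p : B p -> [\/ orient a c p <= 0, orient c d p = 0 | orient d a p = 0].
Proof.
have bca : 0 <= orient c a b by rewrite orient_cycle ltW.
move=> [[[[t]|[t]]|/segment_orient0 h]|/segment_orient0 h].
- rewrite /= in_itv/= => /andP[t0 t1] <-; constructor 1.
  rewrite orient_seg orient_ll mulr0 add0r orientN.
  by rewrite mulrN oppr_le0 mulr_ge0.
- rewrite /= in_itv/= => /andP[t0 t1] <-; constructor 1.
  rewrite orient_seg orient_lr mulr0 addr0 orientN.
  by rewrite mulrN oppr_le0 mulr_ge0 ?bca// subr_ge0.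
- by constructor 2.
- by constructor 3.
Qed.

(** What the closed region loses with its contour leaves an open set; the clopen argument for
    connected components rests on this. *)
Lemma insideE : U `\` B = inside.
Proof.
apply/seteqP; split => p.
- move=> [Up nB].
  have nb1 : ~ segment a b p by move=> h; apply: nB; left; left; left.
  have nb2 : ~ segment b c p by move=> h; apply: nB; left; left; right.
  have nb3 : ~ segment c d p by move=> h; apply: nB; left; right.
  have nb4 : ~ segment d a p by move=> h; apply: nB; right.
  have pos (t : R) : 0 <= t -> t <> 0 -> 0 < t.
    by move=> t0 /eqP t1; rewrite lt_neqAle eq_sym t1.
  (* The ends of the diagonal are on the contour, so the parameter is strictly between 0 and 1, and
     the four values are positive multiples of [orient a b c] or [orient a c d]. *)
  have diag : orient a c p = 0 -> segment a c p ->
      [/\ 0 < orient a b p, 0 < orient b c p, 0 < orient c d p & 0 < orient d a p].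
    move=> h [t]; rewrite /= in_itv/= => /andP[t0 t1] pE.
    have {}t0 : 0 < t.
      apply: pos => // t00; apply: nb1; exists 0; first by rewrite /= in_itv/= lexx ler01.
      by rewrite -pE t00 /seg subr0 !scale1r !scale0r.
    have {}t1 : 0 < 1 - t.
      apply: pos; first by rewrite subr_ge0.
      move=> t11; have {}t11 : t = 1 by lra.
      apply: nb2; exists 1; first by rewrite /= in_itv/= lexx ler01.
      by rewrite -pE t11 /seg subrr !scale1r !scale0r.
    rewrite -pE !orient_seg !orient_ll !orient_lr !mulr0 !addr0 !add0r.
    have bca : 0 < orient b c a by rewrite -orient_cycle.
    have cda : 0 < orient c d a by rewrite -orient_cycle.
    have dac : 0 < orient d a c by rewrite orient_cycle.
    by split; exact: mulr_gt0.
  case: Up => Tp; have [h1 h2 h3] := Tp.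
    have p1 : 0 < orient a b p by apply: pos => // /(tri_edge abc Tp).
    have p2 : 0 < orient b c p.
      have o1 : 0 < orient b c a by rewrite -orient_cycle.
      have T' : tri b c a p by split.
      by apply: pos => // h; apply: nb2; exact: (tri_edge o1 T' h).
    have [h|h] := eqVneq (orient c a p) 0.
      right; apply: diag; first by rewrite orientN h oppr0.
      have o1 : 0 < orient c a b by rewrite orient_cycle.
      have T' : tri c a b p by split.
      have [t] := tri_edge o1 T' h.
      rewrite /= in_itv/= => /andP[t0 t1] <-; exists (1 - t).
        by rewrite /= in_itv/=; apply/andP; split; lra.
      by rewrite /seg opprB addrCA subrr addr0 addrC.
    by left; left; split => //; apply: pos => //; exact/eqP.
  have p2 : 0 < orient c d p.
    have o1 : 0 < orient c d a by rewrite -orient_cycle.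
    have T' : tri c d a p by split.
    by apply: pos => // h; apply: nb3; exact: (tri_edge o1 T' h).
  have p3 : 0 < orient d a p.
    have o1 : 0 < orient d a c by rewrite orient_cycle.
    have T' : tri d a c p by split.
    by apply: pos => // h; apply: nb4; exact: (tri_edge o1 T' h).
  have [h|h] := eqVneq (orient a c p) 0.
    by right; apply: diag => //; exact: tri_edge Tp h.
  by left; right; split => //; apply: pos => //; exact/eqP.
- move=> [[[h1 h2 h3]|[h1 h2 h3]]|[h1 h2 h3 h4]].
  + split; first by left; split; exact: ltW.
    by move=> /contour_in1[h|h|]; [rewrite h ltxx in h1|rewrite h ltxx in h2|rewrite leNgt h3].
  + split; first by right; split; exact: ltW.
    by move=> /contour_in2[|h|h]; [rewrite leNgt h1|rewrite h ltxx in h2|rewrite h ltxx in h3].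
  + split.
      have [h|/ltW h] := leP 0 (orient a c p); first by right; split => //; exact: ltW.
      by left; split; rewrite ?(ltW h1) ?(ltW h2)// orientN oppr_ge0.
    by move=> [[[|]|]|] /segment_orient0 h; move: h1 h2 h3 h4; rewrite h ltxx.
Qed.

(** Relative to the complement of the contour, the region is closed and, being equal to [inside]
    there, also open; a connected set that meets it therefore stays in it. *)
Lemma component_inside x : U x -> ~ B x -> connected_component (~` B) x `<=` U.
Proof.
move=> Ux nBx; set C := connected_component _ _.
have cC : connected C by exact: component_connected.
have sC : C `<=` ~` B by exact: connected_component_sub.
have xC : C x by exact: connected_component_refl.
have e : C `&` U = C `&` inside.
  rewrite -insideE; apply/seteqP; split => p [Cp h]; split => //; last by case: h.
  by split => //; exact: sC.
have <- : C `&` U = C.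
  apply: cC.
  - by exists x.
  - by exists inside; [exact: inside_open|].
  - by exists U; [exact: region_closed|].
by move=> p [].
Qed.

(* The region is star-shaped about a, so that the ray issued from a point x
   outside it in the direction x - a never meets it. *)
Lemma component_outside x : ~ U x ->
  ~ bounded_set (connected_component (~` B) x).
Proof.
move=> nUx [M [_ MC]].
have [Ta _ _] := tri_vertex abc; have [Ta2 _ _] := tri_vertex acd.
pose ray := seg a x @` `[1, +oo[%classic.
have rayU : ray `<=` ~` U.
  move=> p [t t1 <-] Ut; move: t1; rewrite /= in_itv/= andbT => t1; apply: nUx.
  have t0 : 0 < t by exact: lt_le_trans t1.
  have xE : x = seg a (seg a x t) t^-1.
    rewrite /seg [LHS]surjective_pairing [RHS]surjective_pairing /= /GRing.scale /=.
    by congr (_, _); field; rewrite gt_eqF.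
  have ti : 0 <= t^-1 <= 1 by rewrite invr_ge0 ltW//= invf_le1.
  by rewrite xE; case: Ut => Ut; [left|right]; exact: tri_seg.
have rayB : ray `<=` ~` B by move=> p /rayU nU /contour_sub.
have xray : ray x.
  exists 1; first by rewrite /= in_itv/= lexx.
  by rewrite /seg subrr scale0r add0r scale1r.
have cray : connected ray.
  apply: connected_continuous_connected.
    by apply/connected_intervalP; exact: interval_is_interval.
  apply: continuous_subspaceT => t; apply: cvgD; apply: cvgZr_tmp.
  - by apply: cvgB; [exact: cvg_cst|exact: cvg_id].
  - exact: cvg_id.
have rayC : ray `<=` connected_component (~` B) x by exact: connected_component_max.
have xa : 0 < `|x - a|.
  by rewrite normr_gt0 subr_eq0; apply/eqP => xa; apply: nUx; rewrite xa; left.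
pose N := `|M| + `|a| + 1.
have N0 : 0 < N by rewrite /N; have := normr_ge0 M; have := normr_ge0 a; lra.
(* At this parameter the distance to a is [|x - a|] + 2N, so the norm exceeds [|M|] + 1, which
   bounds the component. *)
pose t := 1 + 2 * N / `|x - a|.
have t1 : 1 <= t by rewrite /t lerDl divr_ge0// mulr_ge0// ltW.
have Ct : connected_component (~` B) x (seg a x t).
  by apply: rayC; exists t => //; rewrite /= in_itv/= t1.
have M1 : M < `|M| + 1 by have := ler_norm M; lra.
have := MC _ M1 _ Ct; rewrite /= => le1.
have sE : seg a x t = a + t *: (x - a).
  by rewrite /seg scalerBl scale1r scalerBr -addrA; congr (_ + _); rewrite addrC.
have := ler_normB (seg a x t) a; rewrite {1}sE addrAC subrr add0r normrZ.
rewrite (ger0_norm (le_trans ler01 t1)) {1}/t mulrDl mul1r divfK ?gt_eqF// => le2.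
have := normr_ge0 M; have := normr_ge0 a; rewrite /N in le2; lra.
Qed.

Lemma contour_regionE :
  B `|` [set x | ~ B x /\ bounded_set (connected_component (~` B) x)] = U.
Proof.
apply/seteqP; split => x.
  move=> [/contour_sub//|[nB bC]]; apply: contrapT => nU.
  exact: component_outside bC.
move=> Ux; have [Bx|nBx] := pselect (B x); [by left|right; split => //].
have := compact_bounded region_compact; apply: sub_boundedr.
by move=> P UP y /(component_inside Ux nBx); exact: UP.
Qed.

End two_triangles.

(** Along [p3 p0], [orient p1 p2] passes from positive to nonpositive; along [p1 p2], [orient p3 p0]
    passes from nonpositive to positive. The two zeros have the same positive denominator and give
    the same point. *)
Lemma opposite_edges_meet p0 p1 p2 p3 :
  orient p3 p0 p1 <= 0 -> orient p0 p1 p2 <= 0 ->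
  0 < orient p1 p2 p3 -> 0 < orient p2 p3 p0 ->
  exists2 p, segment p3 p0 p & segment p1 p2 p.
Proof.
move=> h0 h1 h2 h3.
have e : orient p1 p2 p3 - orient p0 p1 p2 = orient p2 p3 p0 - orient p3 p0 p1.
  by rewrite /orient; ring.
have D0 : 0 < orient p1 p2 p3 - orient p0 p1 p2 by lra.
have n0 : orient p1 p2 p3 - orient p0 p1 p2 != 0 by rewrite gt_eqF.
exists (seg p3 p0 (orient p1 p2 p3 / (orient p1 p2 p3 - orient p0 p1 p2))).
  eexists; last by [].
  by rewrite /= in_itv/= divr_ge0 ?(ltW D0) ?(ltW h2)//= ler_pdivrMr// mul1r; lra.
exists (- orient p3 p0 p1 / (orient p1 p2 p3 - orient p0 p1 p2)).
  by rewrite /= in_itv/= divr_ge0 ?(ltW D0) ?oppr_ge0//= ler_pdivrMr// mul1r; lra.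
rewrite /seg [RHS]surjective_pairing [LHS]surjective_pairing /= /GRing.scale /=.
by congr (_, _); move: n0; rewrite /orient => n0; field.
Qed.

End quad_region.

(** * Cutting a simple quadrilateral and integrating weak derivatives over it *)

Section quad_flux.
Context {R : realType}.
Notation leb := (@lebesgue_measure R).
Notation plane := (measurableTypeR R * measurableTypeR R)%type.
Implicit Types (V : 'I_4 -> R * R).

Lemma ord4_add :
  [/\ (0 + 1 = 1 :> 'I_4), (1 + 1 = 2 :> 'I_4), (2 + 1 = 3 :> 'I_4) & (3 + 1 = 0 :> 'I_4)] /\
  [/\ (0 - 1 = 3 :> 'I_4), (1 - 1 = 0 :> 'I_4), (2 - 1 = 1 :> 'I_4) & (3 - 1 = 2 :> 'I_4)] /\
  [/\ (0 + 2 = 2 :> 'I_4), (1 + 2 = 3 :> 'I_4), (2 + 2 = 0 :> 'I_4) & (3 + 2 = 1 :> 'I_4)].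
Proof. by do !split; apply/val_inj. Qed.

Lemma ord4P (P : 'I_4 -> Prop) : P 0 -> P 1 -> P 2 -> P 3 -> forall i, P i.
Proof.
move=> p0 p1 p2 p3 [[|[|[|[|//]]]] hi].
- by rewrite (_ : Ordinal hi = 0)//; apply/val_inj.
- by rewrite (_ : Ordinal hi = 1)//; apply/val_inj.
- by rewrite (_ : Ordinal hi = 2)//; apply/val_inj.
- by rewrite (_ : Ordinal hi = 3)//; apply/val_inj.
Qed.

Lemma sum_ord4 (F : 'I_4 -> R) : \sum_i F i = F 0 + F 1 + F 2 + F 3.
Proof.
rewrite !big_ord_recl big_ord0 addr0 !addrA.
by congr (_ + _ + _ + _); congr F; apply/val_inj.
Qed.

Lemma shoelaceE V : shoelace V =
  (orient (V 0) (V 1) (V 2) + orient (V 0) (V 2) (V 3)) / 2.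
Proof.
have [[e1 e2 e3 e4] _] := ord4_add.
by rewrite /shoelace sum_ord4 e1 e2 e3 e4 /orient; field.
Qed.

(** The values of [orient] at the vertices satisfy A0 + A2 = A1 + A3, which is twice the shoelace
    area, so each opposite pair has a positive member. A pair with both members positive gives the
    diagonal through the other two vertices. Otherwise the two nonpositive values sit at adjacent
    vertices, and [opposite_edges_meet] contradicts simplicity. *)
Lemma ccw_split V : ccw_quadrilateral V ->
  (0 < orient (V 0) (V 1) (V 2) /\ 0 < orient (V 0) (V 2) (V 3)) \/
  (0 < orient (V 1) (V 2) (V 3) /\ 0 < orient (V 1) (V 3) (V 0)).
Proof.
have [[a01 a12 a23 a30] [_ [b0 b1 b2 b3]]] := ord4_add.
move=> [[_ _ opp]]; rewrite shoelaceE => S0.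
have meet i j : j = i + 2 -> (exists2 p, segment (V i) (V (i + 1)) p & segment (V j) (V (j + 1)) p) -> False.
  move=> -> [p p1 p2]; have := opp i => /seteqP[h _].
  by have := h p; apply; split.
set A0 := orient (V 3) (V 0) (V 1); set A1 := orient (V 0) (V 1) (V 2).
set A2 := orient (V 1) (V 2) (V 3); set A3 := orient (V 2) (V 3) (V 0).
have e3 : orient (V 0) (V 2) (V 3) = A3 by rewrite /A3 orient_cycle.
have e0 : orient (V 1) (V 3) (V 0) = A0 by rewrite /A0 [LHS]orient_cycle.
rewrite e3 e0; rewrite e3 in S0.
have s : A0 + A2 = A1 + A3 by rewrite /A0 /A1 /A2 /A3 /orient; ring.
have S1 : 0 < A1 + A3 by rewrite -/A1 in S0; lra.
have [h1|h1] := ltP 0 A1.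
  have [h3|h3] := ltP 0 A3; first by left.
  have [h2|h2] := ltP 0 A2.
    have [h0|h0] := ltP 0 A0; first by right.
    exfalso; apply: (meet 0 2) => //; rewrite a01 a23.
    have [p p1 p2] := @opposite_edges_meet R (V 3) (V 0) (V 1) (V 2) h3 h0 h1 h2.
    by exists p.
  have h0 : 0 < A0 by lra.
  exfalso; apply: (meet 1 3) => //; rewrite a12 a30.
  by have [p p1 p2] := @opposite_edges_meet R (V 2) (V 3) (V 0) (V 1) h2 h3 h0 h1; exists p.
have h3 : 0 < A3 by lra.
have [h2|h2] := ltP 0 A2.
  have [h0|h0] := ltP 0 A0; first by right.
  exfalso; apply: (meet 1 3) => //; rewrite a12 a30.
  by have [p p1 p2] := @opposite_edges_meet R (V 0) (V 1) (V 2) (V 3) h0 h1 h2 h3; exists p.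
have h0 : 0 < A0 by lra.
exfalso; apply: (meet 0 2) => //; rewrite a01 a23.
by have [p p1 p2] := @opposite_edges_meet R (V 1) (V 2) (V 3) (V 0) h1 h2 h3 h0; exists p.
Qed.

Lemma quad_boundaryE V :
  quad_boundary V = contour (V 0) (V 1) (V 2) (V 3) /\
  quad_boundary V = contour (V 1) (V 2) (V 3) (V 0).
Proof.
have [[a01 a12 a23 a30] _] := ord4_add.
have e : quad_boundary V = [set p | exists i, edge V i p].
  by apply/seteqP; split => p [i]; exists i.
have E : quad_boundary V = contour (V 0) (V 1) (V 2) (V 3).
  rewrite e /contour; apply/seteqP; split => p.
    move=> [i]; move: i; apply: ord4P; rewrite /edge ?a01 ?a12 ?a23 ?a30 => h.
    - by left; left; left.
    - by left; left; right.
    - by left; right.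
    - by right.
  move=> [[[|]|]|] h; [exists 0|exists 1|exists 2|exists 3];
    by rewrite /edge ?a01 ?a12 ?a23 ?a30.
split => //; rewrite E /contour; apply/seteqP; split => p.
  move=> [[[|]|]|] h.
  - by right.
  - by left; left; left.
  - by left; left; right.
  - by left; right.
move=> [[[|]|]|] h.
- by left; left; right.
- by left; right.
- by right.
- by left; left; left.
Qed.

(* If one vertex is reflex or flat, only the diagonal issued from it works. *)
Lemma quad_two_triangles V : ccw_quadrilateral V ->
  exists a b c d, [/\ (a, b, c, d) = (V 0, V 1, V 2, V 3) \/
      (a, b, c, d) = (V 1, V 2, V 3, V 0),
    0 < orient a b c, 0 < orient a c d & quad V = tri a b c `|` tri a c d].
Proof.
move=> hV; have [e1 e2] := quad_boundaryE V.
case: (ccw_split hV) => -[h1 h2].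
  exists (V 0), (V 1), (V 2), (V 3); split => //; first by left.
  by rewrite -(contour_regionE h1 h2) /quad e1.
exists (V 1), (V 2), (V 3), (V 0); split => //; first by right.
by rewrite -(contour_regionE h1 h2) /quad e2.
Qed.

Lemma quad_measurable V : ccw_quadrilateral V -> measurable (quad V : set plane).
Proof.
move=> /quad_two_triangles[a [b [c [d [_ _ _ ->]]]]].
by apply: measurableU; exact: tri_measurable.
Qed.

Lemma quad_area V : ccw_quadrilateral V -> area (quad V) = shoelace V.
Proof.
move=> /quad_two_triangles[a [b [c [d [e abc acd ->]]]]].
rewrite /area tri2_area// shoelaceE.
by case: e => -[-> -> -> ->] //; rewrite /orient; field.
Qed.

(** [fine] sends an infinite measure to 0, which the positive shoelace value excludes. *)
Lemma quad_mu2_lty V : ccw_quadrilateral V -> ((@mu2 R) (quad V) < +oo)%E.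
Proof.
move=> hV; have := quad_area hV; have [_ S0] := hV.
rewrite /area; case E : (mu2 (quad V)) => [r| |] /=; rewrite ?ltry//.
by move=> h; rewrite -h ltxx in S0.
Qed.

(** On a set of finite measure, f^2 + 1 is integrable and dominates the absolute value of f. *)
Lemma in_L2_integrable V (f : R * R -> R) : ccw_quadrilateral V ->
  in_L2 (quad V) f -> (@mu2 R).-integrable setT (EFin \o (f \_ (quad V))).
Proof.
move=> hV f2; have i2 := Lfun2_integrable_sqr f2.
have i1 := indic_integrable (quad_measurable hV) (quad_mu2_lty hV).
have mf : measurable_fun [set: plane] (f \_ (quad V)) by exact: set_mem (sub_Lfun_mfun f2).
have i12 := integrableD measurableT i2 i1.
apply: le_integrable i12 => //; first exact/measurable_EFinP.
move=> p _ /=; rewrite lee_fin indicE patchE.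
case: ifPn => pQ; last by rewrite normr0.
rewrite [leRHS]ger0_norm ?addr_ge0 ?sqr_ge0//.
have h : 0 <= (`|f p| - 1) ^+ 2 by exact: sqr_ge0.
rewrite sqrrB1 real_normK ?num_real// -mulr_natr in h.
by have := normr_ge0 (f p); rewrite /=; lra.
Qed.

Definition edge_affine V (v : R * R -> R) := forall j (t : R), 0 <= t <= 1 ->
  v (seg (V j) (V (j + 1)) t) = (1 - t) * v (V j) + t * v (V (j + 1)).

Lemma edge_quad V j (t : R) : 0 <= t <= 1 -> quad V (seg (V j) (V (j + 1)) t).
Proof. by move=> t01; left; exists j => //; exists t. Qed.

Lemma vertex_quad V j : quad V (V j).
Proof.
have := @edge_quad V j 0; rewrite lexx ler01 /seg subr0 scale1r scale0r addr0.
by apply.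
Qed.

(** The boundary integral of v dy, respectively of -v dx. It sees only vertex values of v, hence
    does not depend on the chosen representative of the weak derivative. *)
Lemma weak_partial_flux V (v : R * R -> R) k : ccw_quadrilateral V ->
  in_H1 (quad V) v -> {within quad V, continuous v} -> edge_affine V v ->
  \int[mu2]_(p in quad V) weak_partial (quad V) k v p =
  if k == 0 then
    ((V 1 - V 0).2 * (v (V 0) + v (V 1)) + (V 2 - V 1).2 * (v (V 1) + v (V 2)) +
     (V 3 - V 2).2 * (v (V 2) + v (V 3)) + (V 0 - V 3).2 * (v (V 3) + v (V 0))) / 2
  else
    - ((V 1 - V 0).1 * (v (V 0) + v (V 1)) + (V 2 - V 1).1 * (v (V 1) + v (V 2)) +
     (V 3 - V 2).1 * (v (V 2) + v (V 3)) + (V 0 - V 3).1 * (v (V 3) + v (V 0))) / 2.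
Proof.
move=> hV [v2 hg] cv ev.
set g := weak_partial (quad V) k v.
(* [xget] falls back on 0 only for an empty set; membership in H^1 excludes this, so g is a true
   weak derivative. *)
have [g2 gw] : in_L2 (quad V) g /\ is_weak_partial (quad V) k v g.
  by apply: (@xgetPex _ _ [set g | in_L2 (quad V) g /\ is_weak_partial (quad V) k v g]); exact: hg.
have iu := in_L2_integrable hV v2; have ig := in_L2_integrable hV g2.
have uE p : quad V p -> (v \_ (quad V)) p = v p by move=> qp; rewrite patchE mem_set.
have cu : {within quad V, continuous (v \_ (quad V))}.
  apply: subspace_eq_continuous cv => p /set_mem qp; exact/esym/uE.
have gE : \int[mu2]_(p in quad V) g p = \int[mu2]_(p in quad V) (g \_ (quad V)) p.
  by apply: eq_Rintegral => p /= pq; rewrite patchE pq.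
have weak psi : smooth psi -> test_function (quad V)° psi ->
    \int[mu2]_p ((v \_ (quad V)) p * partial k psi p) =
    - \int[mu2]_p ((g \_ (quad V)) p * psi p).
  move=> _ /gw; rewrite Rintegral_mkcond [in X in _ = - X -> _]Rintegral_mkcond.
  have e (f h : R * R -> R) : (fun p => f p * h p) \_ (quad V) = (fun p => (f \_ (quad V)) p * h p).
    by apply/funext => p; rewrite !patchE; case: ifP => _ //; rewrite mul0r.
  by rewrite !e.
have [[a01 a12 a23 a30] _] := ord4_add.
have aff j : affine_on (v \_ (quad V)) (V j) (V (j + 1)).
  move=> t t01; rewrite !uE ?ev//; [exact: vertex_quad|exact: vertex_quad|exact: edge_quad].
have f0 := aff 0; have f1 := aff 1; have f2 := aff 2; have f3 := aff 3.
rewrite a01 in f0; rewrite a12 in f1; rewrite a23 in f2; rewrite a30 in f3.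
set u := v \_ (quad V) in iu uE cu weak aff f0 f1 f2 f3.
set h := g \_ (quad V) in ig gE weak.
have u0 := uE _ (vertex_quad V 0); have u1 := uE _ (vertex_quad V 1).
have u2 := uE _ (vertex_quad V 2); have u3 := uE _ (vertex_quad V 3).
have [a [b [c [d [abcd abc acd QE]]]]] := quad_two_triangles hV.
(* Edge sums are cyclic, so the result does not depend on which diagonal was used. *)
have vertices (F : R * R -> R * R -> R) : F a b + F b c + F c d + F d a =
    F (V 0) (V 1) + F (V 1) (V 2) + F (V 2) (V 3) + F (V 3) (V 0).
  by case: abcd => -[-> -> -> ->] //; ring.
have [fab [fbc [fcd fda]]] : affine_on u a b /\
   affine_on u b c /\ affine_on u c d /\
   affine_on u d a.
  by case: abcd => -[-> -> -> ->].
rewrite gE; have [k0|k0] := eqVneq k 0.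
  rewrite k0 in weak; rewrite QE in cu.
  have weak' psi : smooth psi -> test_function (tri a b c `|` tri a c d)° psi ->
      \int[mu2]_p (u p * partial 0 psi p) =
      - \int[mu2]_p (h p * psi p).
    by rewrite -QE; exact: weak.
  rewrite {1}QE (weak_flux0 abc acd iu ig cu weak')//.
  rewrite (vertices (fun p q => (q.2 - p.2) * (u p + u q))).
  by rewrite u0 u1 u2 u3.
have k1 : k = 1 by apply/val_inj; case: (k) k0 => -[|[|//]].
rewrite k1 in weak; rewrite QE in cu.
have weak' psi : smooth psi -> test_function (tri a b c `|` tri a c d)° psi ->
    \int[mu2]_p (u p * partial 1 psi p) =
    - \int[mu2]_p (h p * psi p).
  by rewrite -QE; exact: weak.
rewrite {1}QE (weak_flux1 abc acd iu ig cu weak')//.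
rewrite (vertices (fun p q => (q.1 - p.1) * (u p + u q))).
by rewrite u0 u1 u2 u3.
Qed.

End quad_flux.

(** * The stiffness matrix *)

Section stiffness.
Context {R : realType}.
Notation leb := (@lebesgue_measure R).
Implicit Types (V : 'I_4 -> R * R).

Lemma dotE (u v : 'cV[R]_2) : dot u v = u 0 0 * v 0 0 + u 1 0 * v 1 0.
Proof.
rewrite /dot mxE !big_ord_recl big_ord0 addr0 !mxE.
by congr (_ + _ * _); congr (_ _ _); apply/val_inj.
Qed.

Lemma colvE (p : R * R) : (colv p 0 0 = p.1) * (colv p 1 0 = p.2).
Proof. by rewrite !mxE. Qed.

(* The only properties shared by the two means that matter: the residual of
   [Pi1] is unchanged because the alternating sum of the weights vanishes. *)
Definition vertex_weights V (P0 : (R * R -> R) -> R) (w : 'I_4 -> R) :=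
  [/\ w 0 + w 2 = 1 / 2, w 1 + w 3 = 1 / 2 &
      forall v, edge_affine V v -> P0 v = \sum_j w j * v (V j)].

Lemma vertex_mean_weights V : vertex_weights V (vertex_mean V) (fun=> 1 / 4).
Proof.
by split; [field|field|move=> v _; rewrite /vertex_mean !sum_ord4; field].
Qed.

Lemma edge_integral V (v : R * R -> R) j : edge_affine V v ->
  \int[leb]_(t in `[0, 1]) v (seg (V j) (V (j + 1)) t) =
  (v (V j) + v (V (j + 1))) / 2.
Proof.
move=> ev; set m := v (V (j + 1)) - v (V j); set q := v (V j).
transitivity (\int[leb]_(t in `[0, 1]) (m * t + q)).
  apply: eq_Rintegral => t; rewrite inE /= in_itv/= => t01.
  by rewrite ev// /m /q; ring.
have i := @itv_affine_integrable R 0 1 m q.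
have i' := @itv_affine_integrable R (-1) 2 m q.
have ico : leb.-integrable `]0, 1] (EFin \o (fun t : R => m * t + q)).
  by apply: integrableS i' => //; apply: subset_itv; rewrite bnd_simp; lra.
rewrite -(Rintegral_itv_obnd_cbnd ico) -(Rintegral_itv_bndo_bndc i).
by rewrite Rintegral_affine ?ler01// /m /q; field.
Qed.

(** An edge gives half of its length to each end. Two opposite vertices together touch all four
    edges once, so their weights sum to one half. *)
Lemma boundary_mean_weights V : ccw_quadrilateral V ->
  vertex_weights V (boundary_mean V)
    (fun j => (edge_length V j + edge_length V (j - 1)) / (2 * \sum_i edge_length V i)).
Proof.
move=> hV; have [[a01 a12 a23 a30] [[s0 s1 s2 s3] _]] := ord4_add.
have L0 j : 0 <= edge_length V j by rewrite /edge_length sqrtr_ge0.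
have Lpos : 0 < edge_length V 0.
  have [[Vi _ _] _] := hV.
  rewrite /edge_length sqrtr_gt0 dotE !colvE -!expr2.
  rewrite lt_neqAle addr_ge0 ?sqr_ge0// andbT eq_sym paddr_eq0 ?sqr_ge0//.
  rewrite !sqrf_eq0 !subr_eq0; apply/negP => /andP[/eqP h1 /eqP h2].
  have : V (0 + 1) = V 0.
    by rewrite [LHS]surjective_pairing [RHS]surjective_pairing h1 h2.
  by move/Vi.
have P0 : 0 < \sum_i edge_length V i.
  by rewrite sum_ord4; have := L0 1; have := L0 2; have := L0 3; lra.
have Pn : \sum_i edge_length V i != 0 by rewrite gt_eqF.
rewrite sum_ord4 in Pn; split; rewrite ?sum_ord4 ?s0 ?s1 ?s2 ?s3.
- by field.
- by field.
- move=> v ev; rewrite /boundary_mean /boundary_integral !sum_ord4.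
  rewrite (edge_integral 0 ev) (edge_integral 1 ev) (edge_integral 2 ev) (edge_integral 3 ev) a01 a12 a23 a30 s0 s1 s2 s3; field.
  by [].
Qed.

Lemma edge_affine_fst V : edge_affine V fst.
Proof. by move=> j t _; rewrite /seg /= /GRing.scale. Qed.

Lemma edge_affine_snd V : edge_affine V snd.
Proof. by move=> j t _; rewrite /seg /= /GRing.scale. Qed.

Lemma gbc_edge_affine V phi i : gbc V phi -> edge_affine V (phi i).
Proof. by move=> [_ _ h _] j t t01; exact: h. Qed.

(** Only the two edges at [V i] survive in the trapezoidal sum, each with factor 1/2, and their
    vectors add up to [diag_vec V i]. *)
Lemma gbc_gradient V phi i : ccw_quadrilateral V -> gbc V phi ->
  \col_k \int[mu2]_(y in quad V) weak_grad (quad V) (phi i) y k 0 =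
  2^-1 *: colv (perp (diag_vec V i)).
Proof.
move=> hV hphi; have [h1 h2 _ _] := hphi; have [hH hC] := h1 i.
apply/matrixP => k j; rewrite !mxE.
transitivity (\int[mu2]_(y in quad V) weak_partial (quad V) k (phi i) y).
  by apply: eq_Rintegral => y _; rewrite mxE.
rewrite (weak_partial_flux k hV hH hC (gbc_edge_affine i hphi)) !h2.
have [_ [[s0 s1 s2 s3] _]] := ord4_add; have [[a0 a1 a2 a3] _] := ord4_add.
by rewrite /diag_vec; case: ifP => _; move: (i); apply: ord4P;
  rewrite ?a0 ?a1 ?a2 ?a3 ?s0 ?s1 ?s2 ?s3 /=; field.
Qed.

Lemma Pi1E V P0 (v : R * R -> R) (G : R * R) x :
  \col_k \int[mu2]_(y in quad V) weak_grad (quad V) v y k 0 = colv G ->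
  Pi1 (quad V) P0 v x =
  (area (quad V))^-1 * G.1 * x.1 + (area (quad V))^-1 * G.2 * x.2 +
  (P0 v - (area (quad V))^-1 * (G.1 * P0 fst + G.2 * P0 snd)).
Proof. by move=> e; rewrite /Pi1 e dotE !colvE mxE [X in _ + X * _]mxE !colvE /=; ring. Qed.

Lemma grad_Pi1 V P0 (v : R * R -> R) (G : R * R) x :
  \col_k \int[mu2]_(y in quad V) weak_grad (quad V) v y k 0 = colv G ->
  grad (Pi1 (quad V) P0 v) x = (area (quad V))^-1 *: colv G.
Proof.
move=> e; pose a := (area (quad V))^-1.
pose c := P0 v - a * (G.1 * P0 fst + G.2 * P0 snd).
have -> : Pi1 (quad V) P0 v = fun p => id (a * G.1 * p.1 + a * G.2 * p.2 + c).
  by apply/funext => p; exact: Pi1E.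
have d w : 'D_w (fun p : R * R => id (a * G.1 * p.1 + a * G.2 * p.2 + c)) x =
    (a * G.1 * w.1 + a * G.2 * w.2) * 1.
  by have [] := is_derive_affine w (is_derive_id (a * G.1 * x.1 + a * G.2 * x.2 + c) 1).
apply/matrixP => k j; rewrite !mxE /partial d /basis2.
by case: ifP => _ /=; rewrite ?mulr1 ?mulr0 ?addr0 ?add0r.
Qed.

(** The integrand is constant: each gradient carries a factor 1/(2|Q|) and the integration a factor
    |Q|. *)
Lemma consistency_entry V P0 kappa phi i j : ccw_quadrilateral V -> gbc V phi ->
  K_C V P0 kappa phi i j = (4 * area (quad V))^-1 *
    dot (kappa *m colv (perp (diag_vec V j))) (colv (perp (diag_vec V i))).
Proof.
move=> hV hphi; rewrite mxE.
have A0 : area (quad V) != 0 by rewrite quad_area// gt_eqF//; have [] := hV.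
have half (p : R * R) : 2^-1 *: colv p = colv (2^-1 * p.1, 2^-1 * p.2).
  by apply/matrixP => k l; rewrite !mxE; case: ifP.
have g l := gbc_gradient l hV hphi.
have dZ (s t : R) (u w : 'cV[R]_2) : dot (kappa *m (s *: u)) (t *: w) =
    s * t * dot (kappa *m u) w.
  by rewrite /dot -!scalemxAr linearZ /= -scalemxAl scalerA [LHS]mxE (mulrC t).
under eq_Rintegral => x _.
  rewrite (grad_Pi1 P0 x (etrans (g j) (half _))) (grad_Pi1 P0 x (etrans (g i) (half _))).
  rewrite -!half !scalerA dZ; over.
rewrite Rintegral_cst; last exact: quad_measurable.
rewrite -/(area (quad V)).
by field.
Qed.

Lemma det3E (M : 'M[R]_3) : \det M =
  M 0 0 * (M 1 1 * M 2 2 - M 1 2 * M 2 1) -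
  M 0 1 * (M 1 0 * M 2 2 - M 1 2 * M 2 0) +
  M 0 2 * (M 1 0 * M 2 1 - M 1 1 * M 2 0).
Proof.
have D2 (N : 'M[R]_2) : \det N = N 0 0 * N 1 1 - N 0 1 * N 1 0.
  rewrite (expand_det_row _ 0) !big_ord_recl big_ord0 addr0 /cofactor !det_mx11 !mxE /=.
  have -> : lift 0 0 = 1 :> 'I_2 by apply/val_inj.
  have -> : lift 1 0 = 0 :> 'I_2 by apply/val_inj.
  by rewrite expr0 expr1 mul1r mulN1r mulrN.
rewrite (expand_det_row _ 0) !big_ord_recl big_ord0 addr0 /cofactor !D2 !mxE /=.
have e00 : lift 0 0 = 1 :> 'I_3 by apply/val_inj.
have e01 : lift 0 1 = 2 :> 'I_3 by apply/val_inj.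
have e10 : lift 1 0 = 0 :> 'I_3 by apply/val_inj.
have e11 : lift 1 1 = 2 :> 'I_3 by apply/val_inj.
have e20 : lift 2 0 = 0 :> 'I_3 by apply/val_inj.
have e21 : lift 2 1 = 1 :> 'I_3 by apply/val_inj.
have f1 : lift ord0 ord0 = 1 :> 'I_3 by apply/val_inj.
have f2 : lift ord0 (lift ord0 ord0) = 2 :> 'I_3 by apply/val_inj.
rewrite ?f2 ?f1 ?e00 ?e01 ?e10 ?e11 ?e20 ?e21 /bump /=.
rewrite expr0 expr1 expr2; ring.
Qed.

Lemma TsignedE V i : Tsigned V i = 2^-1 *
  orient (V (lift i 0)) (V (lift i 1)) (V (lift i 2)).
Proof. by rewrite /Tsigned det3E !mxE /= /orient; ring. Qed.

Lemma lift4E :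
  [/\ [/\ lift 0 0 = 1 :> 'I_4, lift 0 1 = 2 :> 'I_4 & lift 0 2 = 3 :> 'I_4],
      [/\ lift 1 0 = 0 :> 'I_4, lift 1 1 = 2 :> 'I_4 & lift 1 2 = 3 :> 'I_4],
      [/\ lift 2 0 = 0 :> 'I_4, lift 2 1 = 1 :> 'I_4 & lift 2 2 = 3 :> 'I_4] &
      [/\ lift 3 0 = 0 :> 'I_4, lift 3 1 = 1 :> 'I_4 & lift 3 2 = 2 :> 'I_4]].
Proof. by split; split; apply/val_inj. Qed.

(** The dependence on the vertex is only a sign, with the 1-based exponent [k.+1] as in [Tprime]:
    the residual matrix has rank at most one. *)
Lemma residual_entry V P0 phi (w : 'I_4 -> R) j k :
  ccw_quadrilateral V -> gbc V phi -> vertex_weights V P0 w ->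
  phi j (V k) - Pi1 (quad V) P0 (phi j) (V k) =
  (-1) ^+ k.+1 * Tprime V j / 2.
Proof.
move=> hV hphi [w02 w13 wP]; have [_ hd _ _] := hphi.
have half (p : R * R) : 2^-1 *: colv p = colv (2^-1 * p.1, 2^-1 * p.2).
  by apply/matrixP => r l; rewrite !mxE; case: ifP.
rewrite (Pi1E P0 (V k) (etrans (gbc_gradient j hV hphi) (half _))).
rewrite (wP _ (gbc_edge_affine j hphi)) (wP _ (@edge_affine_fst V)).
rewrite (wP _ (@edge_affine_snd V)) !sum_ord4 !hd /Tprime TsignedE (quad_area hV).
have S0 : shoelace V != 0 by rewrite gt_eqF//; have [] := hV.
have S0n : 2 * shoelace V != 0 by rewrite mulf_neq0.
rewrite shoelaceE /orient [2 * _]mulrC divfK// in S0n.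
rewrite shoelaceE /orient.
(* The remaining weights [w 0] and [w 1] stay free and cancel in each of the sixteen rational
   identities below. *)
have -> : w 2 = 1 / 2 - w 0 by lra.
have -> : w 3 = 1 / 2 - w 1 by lra.
rewrite /diag_vec.
have [[a0 a1 a2 a3] [[s0 s1 s2 s3] _]] := ord4_add.
have [[l00 l01 l02] [l10 l11 l12] [l20 l21 l22] [l30 l31 l32]] := lift4E.
have [n0 n1 n2 n3] : [/\ (0 : 'I_4) = 0%N :> nat, (1 : 'I_4) = 1%N :> nat,
  (2 : 'I_4) = 2%N :> nat & (3 : 'I_4) = 3%N :> nat] by [].
by move: j k; apply: ord4P; apply: ord4P;
  rewrite ?a0 ?a1 ?a2 ?a3 ?s0 ?s1 ?s2 ?s3 ?(l00, l01, l02, l10, l11, l12)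
    ?(l20, l21, l22, l30, l31, l32) ?(n0, n1, n2, n3) /=; field; rewrite S0n.
Qed.

(** The signs square to 1, and four equal terms with factor 1/4 add up to the product, which absorbs
    the factor 1/2 of each residual. *)
Lemma stabilization_entry V P0 phi tau (w : 'I_4 -> R) i j :
  ccw_quadrilateral V -> gbc V phi -> vertex_weights V P0 w ->
  K_S V P0 tau phi i j = tau * (Tprime V i * Tprime V j).
Proof.
move=> hV hphi hw; rewrite mxE; congr (_ * _).
under eq_bigr => k _ do rewrite !(residual_entry _ _ hV hphi hw).
have sq (k : 'I_4) : (-1) ^+ k.+1 * (-1) ^+ k.+1 = 1 :> R by rewrite -expr2 sqrr_sign.
transitivity (\sum_(k < 4) (Tprime V i * Tprime V j / 4)).
  apply: eq_bigr => k _.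
  transitivity ((-1) ^+ k.+1 * (-1) ^+ k.+1 * (Tprime V i * Tprime V j / 4)).
    by field.
  by rewrite sq mul1r.
by rewrite sum_ord4; field.
Qed.

End stiffness.

Theorem mainTheorem2 (R : realType) (V : 'I_4 -> R * R)
    (hV : ccw_quadrilateral V)
    (kappa : 'M[R]_2) (hkappa : sym_posdef kappa)
    (phi : 'I_4 -> R * R -> R) (hphi : gbc V phi)
    (P0 : (R * R -> R) -> R)
    (hP0 : P0 = vertex_mean V \/ P0 = boundary_mean V)
    (tau : R) :
  K_VEM V P0 kappa tau phi =
    (\matrix_(i, j) ((4 * area (quad V))^-1 *
       dot (kappa *m colv (perp (diag_vec V j))) (colv (perp (diag_vec V i)))))
    + tau *: (\matrix_(i, j) (Tprime V i * Tprime V j)).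
Proof.
have [w hw] : exists w, vertex_weights V P0 w.
  by case: hP0 => ->; eexists; [exact: vertex_mean_weights|exact: boundary_mean_weights].
apply/matrixP => i j; rewrite /K_VEM mxE (consistency_entry _ _ _ _ hV hphi).
by rewrite (stabilization_entry _ _ _ hV hphi hw) !mxE.
Qed.
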